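(* Let $\mathcal{H}$ be a finite dimensional real or complex inner product space, let $\mathcal{X}$ and $\mathcal{Y}$ be subspaces of $\mathcal{H}$ with $\dim\mathcal{X}\le\dim\mathcal{Y}$, let the linear operator $A:\mathcal{H}\to\mathcal{H}$ be Hermitian, let $\mathcal{X}$ be $A$-invariant and correspond to the contiguous set of the largest eigenvalues of $A$, and let $\Lambda_{\dim\mathcal{X}}\left((P_{\mathcal{Y}}A)|_{\mathcal{Y}}\right)$ denote the vector of the $\dim\mathcal{X}$ largest eigenvalues of $(P_{\mathcal{Y}}A)|_{\mathcal{Y}}$. Then $$0\le\Lambda\left((P_{\mathcal{X}}A)|_{\mathcal{X}}\right)-\Lambda_{\dim\mathcal{X}}\left((P_{\mathcal{Y}}A)|_{\mathcal{Y}}\right)\prec_w\left(\Lambda\left((P_{\mathcal{X}}A)|_{\mathcal{X}}\right)-\lambda_{\min(\mathcal{X}+\mathcal{Y})}\right)\sin^2\Theta(\mathcal{X},\mathcal{Y}).$$ If $\Theta(\mathcal{X},\mathcal{Y})<\pi/2$ and $\Lambda\left((P_{\mathcal{X}}A)|_{\mathcal{X}}\right)>\lambda_{\min(\mathcal{X}+\mathcal{Y})}$ (component-wise), then $\Lambda_{\dim\mathcal{X}}\left((P_{\mathcal{Y}}A)|_{\mathcal{Y}}\right)>\lambda_{\min(\mathcal{X}+\mathcal{Y})}$, $$0\le\log\frac{\Lambda\left((P_{\mathcal{X}}A)|_{\mathcal{X}}\right)-\lambda_{\min(\mathcal{X}+\mathcal{Y})}}{\Lambda_{\dim\mathcal{X}}\left((P_{\mathcal{Y}}A)|_{\mathcal{Y}}\right)-\lambda_{\min(\mathcal{X}+\mathcal{Y})}}\prec_w\log\left(1+\tan^2\Theta(\mathcal{X},\mathcal{Y})\right),$$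 and $$0\le\frac{\Lambda\left((P_{\mathcal{X}}A)|_{\mathcal{X}}\right)-\Lambda_{\dim\mathcal{X}}\left((P_{\mathcal{Y}}A)|_{\mathcal{Y}}\right)}{\Lambda_{\dim\mathcal{X}}\left((P_{\mathcal{Y}}A)|_{\mathcal{Y}}\right)-\lambda_{\min(\mathcal{X}+\mathcal{Y})}}\prec_w\tan^2\Theta(\mathcal{X},\mathcal{Y}).$$
   Context: For a subspace $\mathcal{Z}$, $P_{\mathcal{Z}}$ is the orthogonal projector onto $\mathcal{Z}$, and $(P_{\mathcal{Z}}A)|_{\mathcal{Z}}$ is the restriction of $P_{\mathcal{Z}}A$ to $\mathcal{Z}$, a Hermitian operator on $\mathcal{Z}$. $\Lambda(\cdot)$ is the vector of eigenvalues of a Hermitian operator, repeated according to multiplicity and arranged in decreasing (i.e. nonincreasing) order; $\Lambda_{\dim\mathcal{X}}$ is likewise counted with multiplicity and arranged in decreasing order. An $A$-invariant subspace $\mathcal{X}$ corresponds to the contiguous set of the largest eigenvalues of $A$ if the eigenvalues of $A|_{\mathcal{X}}$ are the $\dim\mathcal{X}$ largest eigenvalues of $A$, counting multiplicities. $\lambda_{\min(\mathcal{X}+\mathcal{Y})}$ is the smallest eigenvalue of $(P_{\mathcal{X}+\mathcal{Y}}A)|_{\mathcal{X}+\mathcal{Y}}$. Principal angles: for $\dim\mathcal{X}\le\dim\mathcal{Y}$, the vector $\Theta(\mathcal{X},\mathcal{Y})$ of $\dim\mathcal{X}$ angles from $\mathcal{X}$ to $\mathcal{Y}$ has components in $[0,\pi/2]$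 arranged in decreasing order, and the components of $\cos^2\Theta(\mathcal{X},\mathcal{Y})$ are the eigenvalues of $(P_{\mathcal{X}}P_{\mathcal{Y}})|_{\mathcal{X}}$ arranged in increasing order. Functions (including $\log$), products, quotients and inequalities ($\le$, $<$) of vectors are component-wise; a scalar in a vector expression denotes the constant vector. For a real vector $x$, $x^\downarrow$ denotes its rearrangement in decreasing order. For real $n$-vectors, $x\prec_w y$ (weak majorization) means $\sum_{i=1}^k x_i^\downarrow\le\sum_{i=1}^k y_i^\downarrow$ for $k=1,\ldots,n$. *)

(* Defs.v *)
From HB Require Import structures.
From mathcomp Require Import all_boot all_order all_algebra.
From mathcomp Require Import complex.
From mathcomp Require Import reals exp trigo.

Set Implicit Arguments.
Unset Strict Implicit.
Unset Printing Implicit Defensive.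

Import Order.TTheory GRing.Theory Num.Theory.
Import passmx.
Local Open Scope ring_scope.

Variant scalar_kind := RealScalars | ComplexScalars.

Definition scalar_field (R : realType) (k : scalar_kind) : numFieldType :=
  match k with RealScalars => R | ComplexScalars => R[i] end.

Definition scalar_conj (R : realType) (k : scalar_kind) :
    involutive_rmorphism (scalar_field R k) :=
  match k with
  | RealScalars => @idfun R
  | ComplexScalars => @Num.conj R[i]
  end.

Definition scalar_to_complex (R : realType) (k : scalar_kind) :
    {rmorphism scalar_field R k -> R[i]} :=
  match k with
  | RealScalars => real_complex R
  | ComplexScalars => @idfun R[i]
  end.

Section Operators.
Variables (R : realType) (k : scalar_kind).
Local Notation K := (scalar_field R k).

(* The roots, with multiplicity, of the characteristic polynomial, in
   nonincreasing order.  For Hermitian operators, the only ones to which this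
   is applied, all the roots are real and [complex.Re] merely moves them from
   R[i] to R. *)
Definition eigvals (V : vectType K) (f : 'End(V)) : seq R :=
  let M := mxof (vbasis {:V}) (vbasis {:V}) f in
  let p := map_poly (scalar_to_complex R k) (char_poly M) in
  sort >=%R [seq complex.Re z | z <- sval (closed_field_poly_normal p)].

Variable H : vectType K.
Implicit Types (X Y Z : {vspace H}) (A B : 'End(H)).

(* B|_Z as an operator on Z, for B mapping Z into Z; [vsproj Z] is then only
   the corestriction to Z. *)
Definition restrict_op B Z : 'End(subvs_of Z) := linfun (vsproj Z \o B \o vsval).

Variable dotp : {dot H for scalar_conj R k}.

Definition hermitian_operator A := forall u v, dotp (A u) v = dotp u (A v).

Definition orth_proj Z : 'End(H) := daddv_pi Z (orthov dotp Z).

(* (P_Z A)|_Z *)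
Definition compression A Z : 'End(subvs_of Z) :=
  restrict_op (orth_proj Z \o A)%VF Z.

(* The last entry of a nonincreasing list; 0 by convention if Z is the zero
   space, which has no eigenvalue. *)
Definition min_eigval A Z : R := last 0 (eigvals (compression A Z)).

Definition contiguous_largest A X :=
  eigvals (restrict_op A X) = take (\dim X) (eigvals A).

(* The squared cosines are taken in increasing order, so that the angles come
   in decreasing order. *)
Definition principal_angles X Y : seq R :=
  [seq acos (Num.sqrt c) |
    c <- rev (eigvals (restrict_op (orth_proj X \o orth_proj Y)%VF X))].

End Operators.

Section Majorization.
Variables (R : realType) (n : nat).
Implicit Types x y : 'I_n -> R.

Definition decreasing_rearr x : seq R := sort >=%R (codom x).

Definition weak_major x y :=
  forall m : nat, (1 <= m <= n)%N ->
    \sum_(i < m) (decreasing_rearr x)`_i <= \sum_(i < m) (decreasing_rearr y)`_i.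

End Majorization.

(* Main.v *)
Require Import Defs.
From HB Require Import structures.
From mathcomp Require Import all_boot all_order all_algebra.
From mathcomp Require Import complex.
From mathcomp Require Import reals exp trigo.
From mathcomp Require Import perm sequences ring lra.

Set Implicit Arguments.
Unset Strict Implicit.
Unset Printing Implicit Defensive.

Import Order.TTheory GRing.Theory Num.Theory.
Local Open Scope ring_scope.

(* Put [a = Lambda(A|_X) - lmin] and let [c] be the squared cosines, i.e. the
   eigenvalues of [K = (P_X P_Y)|_X].  As [X] is invariant and [A - lmin] is
   nonnegative on [X + Y], that operator dominates its part supported on [X];
   compressing this part to [Y] shows that the Ritz values of [Y], shifted by
   [lmin], are at least the eigenvalues [g] of [D^(1/2) K D^(1/2)], where
   [D = diag(a)].  It remains to compare [g] with [a] over an arbitrary index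
   set [J] of size [k].  Following Li and Mathias, [K] is truncated at its
   [k]-th smallest eigenvalue, after which all the gaps (or ratios) have the
   same sign, so that the sum over [J] is at most the sum over all the indices,
   which is a trace (or the logarithm of a determinant).  The tangent bound
   follows from the logarithmic one because [exp] is convex and increasing. *)

(** * Abel summation, decreasing rearrangements and weak majorization *)

Section Sequences.
Variable R : realType.

(** Summation by parts as an induction: the partial sum of [d] is nonnegative, so passing from the
    weight [w m] to the smaller [w m.+1] can only decrease their product. *)
Lemma abel_sum_ge0 (n : nat) (w d : nat -> R) :
  (forall i, (i.+1 < n)%N -> w i.+1 <= w i) ->
  (forall i, (i < n)%N -> 0 <= w i) ->
  (forall m, (m <= n)%N -> 0 <= \sum_(i < m) d i) ->
  0 <= \sum_(i < n) w i * d i.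
Proof.
move=> wdec w0 d0.
suff H m : (m < n)%N -> w m * (\sum_(i < m.+1) d i) <= \sum_(i < m.+1) w i * d i.
  case: n => [|n] in wdec w0 d0 H *; first by rewrite big_ord0.
  by apply: le_trans (H n _) => //; rewrite mulr_ge0 ?w0 ?d0.
elim: m => [|m IH] lt_mn; first by rewrite !big_ord_recl !big_ord0 !addr0.
rewrite big_ord_recr/= [leRHS]big_ord_recr/= mulrDr lerD2r.
apply: le_trans (IH (ltnW lt_mn)).
by rewrite ler_wpM2r ?wdec // d0 // ltnW.
Qed.

Lemma sorted_ler_nth (s : seq R) i j : sorted >=%R s ->
  (i <= j)%N -> (j < size s)%N -> s`_j <= s`_i.
Proof.
move=> ss ij js.
have tr : transitive (>=%R : rel R) by move=> a b c ab bc; exact: le_trans bc ab.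
have H := sorted_leq_nth tr (@lexx _ R) 0 ss.
by apply: H => //; rewrite inE // (leq_ltn_trans ij).
Qed.

Lemma sort_codom_perm n (x : 'I_n -> R) :
  exists s : 'S_n, sort >=%R (codom x) = [seq x (s i) | i : 'I_n] /\
    forall i j : 'I_n, (i <= j)%N -> x (s j) <= x (s i).
Proof.
have tot : total (>=%R : rel R) by move=> a b; exact: le_total.
have pe : perm_eq (in_tuple (codom x)) (sort >=%R (codom x)).
  by rewrite perm_sym perm_sort.
have sz : size (sort >=%R (codom x)) = n by rewrite size_sort size_codom card_ord.
have [t tE] : exists t : n.-tuple R, tval t = sort >=%R (codom x).
  by exists (tcast sz (in_tuple _)); rewrite val_tcast.
have [u uE] : exists u : n.-tuple R, tval u = codom x.
  have sz' : size (codom x) = n by rewrite size_codom card_ord.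
  by exists (tcast sz' (in_tuple _)); rewrite val_tcast.
have: perm_eq t u by rewrite tE uE perm_sort.
move=> /tuple_permP[s ts].
have xE i : tnth u i = x i.
  rewrite (tnth_nth 0) uE /codom /image_mem (nth_map i) ?size_enum_ord //.
  by rewrite nth_ord_enum.
have E : sort >=%R (codom x) = [seq x (s i) | i : 'I_n].
  by rewrite -tE ts; apply: eq_map => i; rewrite xE.
exists s; split=> // i j ij.
have nE (l : 'I_n) : x (s l) = (sort >=%R (codom x))`_l.
  by rewrite E (nth_map l) ?size_enum_ord // nth_ord_enum.
by rewrite !nE sorted_ler_nth ?sz ?sort_sorted.
Qed.

(** [J] is the set of places of the [m] largest entries. This trades sorted partial sums for sums
    over index sets. *)
Lemma decreasing_rearr_sum n (x : 'I_n -> R) m : (m <= n)%N ->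
  exists J : {set 'I_n}, #|J| = m /\
   \sum_(i < m) (decreasing_rearr x)`_i = \sum_(i in J) x i.
Proof.
move=> le_mn; have [s [E _]] := sort_codom_perm x.
exists [set s (widen_ord le_mn i) | i : 'I_m]; split.
  rewrite card_imset ?card_ord // => i j /perm_inj /(congr1 val) /= ij.
  exact: val_inj.
rewrite big_imset /= => [|i j _ _ /perm_inj /(congr1 val) /= ij]; last exact: val_inj.
apply: eq_big => [i|i _]; first by rewrite inE.
rewrite /decreasing_rearr E (nth_map (widen_ord le_mn i)) ?size_enum_ord ?(leq_trans (ltn_ord i)) //.
congr (x (s _)); apply: val_inj => /=.
by rewrite nth_enum_ord // (leq_trans (ltn_ord i)).
Qed.

Lemma decreasing_rearr_id n (x : 'I_n -> R) (i : 'I_n) :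
  (forall i j : 'I_n, (i <= j)%N -> x j <= x i) ->
  (decreasing_rearr x)`_i = x i.
Proof.
move=> xdec.
have tr : transitive (>=%R : rel R) by move=> a b c ab bc; exact: le_trans bc ab.
rewrite /decreasing_rearr sorted_sort //; last first.
  rewrite /codom /image_mem sorted_map.
  have: sorted ltn (map val (enum 'I_n)) by rewrite val_enum_ord iota_ltn_sorted.
  rewrite sorted_map; apply: sub_sorted => a b /= /ltnW; exact: xdec.
by rewrite /codom /image_mem (nth_map i) ?size_enum_ord // nth_ord_enum.
Qed.

(** As [y] is already sorted, only the left-hand side involves a rearrangement, and bounding the
    sums over all index sets avoids knowing which one is selected. *)
Lemma weak_major_le_on_sets n (x y : 'I_n -> R) :
  (forall i j : 'I_n, (i <= j)%N -> y j <= y i) ->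
  (forall J : {set 'I_n}, (0 < #|J|)%N ->
     \sum_(i in J) x i <= \sum_(i < n | (i < #|J|)%N) y i) ->
  weak_major x y.
Proof.
move=> ydec H m /andP[m0 mn].
have [J [Jm ->]] := decreasing_rearr_sum x mn.
apply: le_trans (H J _) _; first by rewrite Jm.
rewrite Jm (big_ord_widen n (fun i => (decreasing_rearr y)`_i)) //.
by apply: ler_sum => i _; rewrite decreasing_rearr_id.
Qed.

(** Convexity in the form needed for Abel summation: the slope [expR x] becomes the weight. *)
Lemma expR_tangent (x y : R) : expR x * (y - x) <= expR y - expR x.
Proof.
have -> : expR y = expR x * expR (y - x) by rewrite -expRD addrC subrK.
rewrite -[X in _ <= _ - X]mulr1 -mulrBr ler_pM2l ?expR_gt0 //.
by rewrite lerBrDl expR_ge1Dx.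
Qed.

Lemma decreasing_rearr_homo n (x : 'I_n -> R) (f : R -> R) (i : 'I_n) :
  {homo f : a b / a <= b} ->
  (decreasing_rearr (f \o x))`_i = f (decreasing_rearr x)`_i.
Proof.
move=> fh; have [s [E dec]] := sort_codom_perm x.
have nE (l : 'I_n) : (decreasing_rearr x)`_l = x (s l).
  by rewrite /decreasing_rearr E (nth_map l) ?size_enum_ord // nth_ord_enum.
(* The rearrangement ignores the order of the entries, so [x] may be replaced by its sorted version
   [x \o s], whose image under [f] is already sorted. *)
have -> : decreasing_rearr (f \o x) = decreasing_rearr (f \o x \o s).
  rewrite /decreasing_rearr; apply/perm_sortP.
  - by move=> a b; exact: le_total.
  - by move=> a b c ab bc; exact: le_trans bc ab.
  - by move=> a b /andP[ab ba]; apply/eqP; rewrite eq_le; apply/andP.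
  rewrite /codom /image_mem [X in perm_eq _ X]map_comp; apply: perm_map.
  rewrite perm_sym; apply: uniq_perm; rewrite ?(map_inj_uniq perm_inj) ?enum_uniq //.
  move=> j; rewrite mem_enum inE; apply/mapP; exists (s^-1%g j) => //.
    by rewrite mem_enum.
  by rewrite permKV.
by rewrite decreasing_rearr_id ?nE // => a b ab /=; apply: fh; exact: dec.
Qed.

(** Tangents at the sorted entries of [x] bound each difference from below; their slopes are
    positive and nonincreasing, so Abel summation applies. Subtracting 1 turns a ratio into a
    relative gap, and [1 + tan ^+ 2] into [tan ^+ 2]. *)
Lemma weak_major_expR n (x y : 'I_n -> R) : weak_major x y ->
  weak_major (fun i => expR (x i) - 1) (fun i => expR (y i) - 1).
Proof.
move=> xy m /[dup] mm /andP[m0 mn].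
have fh : {homo (fun a : R => expR a - 1) : a b / a <= b}.
  by move=> a b ab; rewrite lerD2r ler_expR.
have E (z : 'I_n -> R) (i : 'I_m) :
   (decreasing_rearr (fun i => expR (z i) - 1))`_i = expR (decreasing_rearr z)`_i - 1.
  exact: (decreasing_rearr_homo z (widen_ord mn i) fh).
under eq_bigr do rewrite E; under [leRHS]eq_bigr do rewrite E.
rewrite -subr_ge0 -sumrB.
apply: le_trans (_ : 0 <= \sum_(i < m) expR (decreasing_rearr x)`_i *
    ((decreasing_rearr y)`_i - (decreasing_rearr x)`_i)) _.
  apply: (@abel_sum_ge0 m (fun i => expR (decreasing_rearr x)`_i)
    (fun i => (decreasing_rearr y)`_i - (decreasing_rearr x)`_i)).
  - move=> i im; rewrite ler_expR sorted_ler_nth //.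
      by apply: sort_sorted => a b; exact: le_total.
    by rewrite size_sort size_codom card_ord (leq_trans im).
  - by move=> *; exact: expR_ge0.
  - case=> [|l] lm; first by rewrite big_ord0.
    by rewrite sumrB subr_ge0 xy // (leq_trans lm mn).
apply: ler_sum => i _.
have := expR_tangent (decreasing_rearr x)`_i (decreasing_rearr y)`_i; lra.
Qed.

End Sequences.

(** * Hermitian matrices: quadratic forms and ordered eigenvalues *)

Lemma char_poly_similar (F : fieldType) n m (P : 'M[F]_(n, m)) (Q : 'M_(m, n)) B :
  P *m Q = 1%:M -> Q *m P = 1%:M -> char_poly (P *m B *m Q) = char_poly B.
Proof.
move=> PQ QP.
have nm : n = m by apply/eqP; rewrite eqn_leq (mulmx1_min PQ) (mulmx1_min QP).
subst m; rewrite /char_poly /char_poly_mx.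
have -> : 'X%:M - map_mx polyC (P *m B *m Q) =
  map_mx polyC P *m ('X%:M - map_mx polyC B) *m map_mx polyC Q.
  rewrite !map_mxM mulmxBr mulmxBl; congr (_ - _).
  by rewrite scalar_mxC -mulmxA -map_mxM PQ map_mx1 mulmx1.
rewrite !det_mulmx mulrAC -det_mulmx -map_mxM PQ map_mx1 det1 mul1r.
by [].
Qed.

(* Locked, for otherwise unification unfolds [char_poly]. *)
HB.lock Definition hev (R : realType) n (N : 'M[R[i]]_n) : seq R :=
  sort >=%R [seq complex.Re z | z <- sval (closed_field_poly_normal (char_poly N))].

Section Hermitian.
Local Open Scope sesquilinear_scope.
Local Open Scope complex_scope.
Variable R : realType.
Local Notation C := R[i].

Lemma adjM m n p (A : 'M[C]_(m, n)) (B : 'M[C]_(n, p)) :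
  (A *m B)^t* = B^t* *m A^t*.
Proof. by rewrite trmx_mul map_mxM. Qed.

Lemma adjB m n (A B : 'M[C]_(m, n)) : (A - B)^t* = A^t* - B^t*.
Proof. by rewrite linearB /= map_mxB. Qed.

Lemma adj_scalar n (c : R) : ((c%:C)%:M : 'M[C]_n)^t* = (c%:C)%:M.
Proof.
rewrite tr_scalar_mx map_scalar_mx; congr (_%:M).
by apply: (@conjc_real R).
Qed.

Definition rdiag n (l : 'I_n -> R) : 'M[C]_n := diag_mx (\row_i (l i)%:C).

Lemma adj_rdiag n (l : 'I_n -> R) : (rdiag l)^t* = rdiag l.
Proof.
rewrite tr_diag_mx map_diag_mx; congr diag_mx.
by apply/rowP=> i; rewrite !mxE; apply: (@conjc_real R).
Qed.

Lemma eq_rdiag n (l l' : 'I_n -> R) : l =1 l' -> rdiag l = rdiag l'.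
Proof. by move=> ll; congr diag_mx; apply/rowP => i; rewrite !mxE ll. Qed.

Lemma rdiagM n (l l' : 'I_n -> R) : rdiag l *m rdiag l' = rdiag (fun i => l i * l' i).
Proof.
by rewrite mulmx_diag; congr diag_mx; apply/rowP => i; rewrite !mxE rmorphM.
Qed.

Lemma rdiagB n (l l' : 'I_n -> R) : rdiag l - rdiag l' = rdiag (fun i => l i - l' i).
Proof.
by rewrite -linearB; congr diag_mx; apply/rowP => i; rewrite !mxE rmorphB.
Qed.

Lemma rdiag_const n (c : R) : rdiag (fun _ : 'I_n => c) = (c%:C)%:M.
Proof. by rewrite -diag_const_mx; congr diag_mx; apply/rowP => i; rewrite !mxE. Qed.

Lemma rdiag1 n : rdiag (fun _ : 'I_n => 1) = 1%:M.
Proof. by rewrite rdiag_const rmorph1. Qed.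

Lemma hermitian_congr n m (T : 'M[C]_(m, n)) (N : 'M[C]_n) : N^t* = N ->
  (T *m N *m T^t*)^t* = T *m N *m T^t*.
Proof. by move=> NN; rewrite !adjM trmxCK NN mulmxA. Qed.

Lemma hermitian_unitary_congr n m (T : 'M[C]_(m, n)) (l : 'I_m -> R) :
  (T^t* *m rdiag l *m T)^t* = T^t* *m rdiag l *m T.
Proof. by rewrite !adjM trmxCK adj_rdiag mulmxA. Qed.

(** The squared modulus, valued in [R] so that real inequalities apply to it. *)
Definition nsq (z : C) : R := complex.Re z ^+ 2 + complex.Im z ^+ 2.

Lemma nsq_ge0 z : 0 <= nsq z. Proof. by rewrite addr_ge0 ?sqr_ge0. Qed.

Lemma nsq_eq0 z : (nsq z == 0) = (z == 0).
Proof. by case: z => a b; rewrite paddr_eq0 ?sqr_ge0 // !sqrf_eq0 eq_complex. Qed.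

Lemma nsq_mulCJ (z : C) : z * Num.conj z = (nsq z)%:C.
Proof.
case: z => a b; apply/eqP; rewrite eq_complex /= /nsq /=.
by apply/andP; split; apply/eqP; ring.
Qed.

Lemma Re_sum I r (P : pred I) (F : I -> C) :
  complex.Re (\sum_(i <- r | P i) F i) = \sum_(i <- r | P i) complex.Re (F i).
Proof. by apply: (big_morph (@complex.Re R)) => // -[a b] [c d]. Qed.

Lemma Re_mul_realC (a : R) (z : C) : complex.Re (a%:C * z) = a * complex.Re z.
Proof. by case: z => x y /=; rewrite mul0r subr0. Qed.

(** The quadratic form of [N]. Vectors are rows and matrices act on the right; for Hermitian [N] the
    value is real, so taking the real part loses nothing. *)
Definition qf n (N : 'M[C]_n) (v : 'rV[C]_n) : R :=
  complex.Re ((v *m N *m v^t*) 0 0).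

Lemma qf_mul n m (N : 'M[C]_n) (T : 'M[C]_(m, n)) v :
  qf N (v *m T) = qf (T *m N *m T^t*) v.
Proof. by rewrite /qf adjM !mulmxA. Qed.

Lemma qfB n (N N' : 'M[C]_n) v : qf (N - N') v = qf N v - qf N' v.
Proof.
rewrite /qf mulmxBr mulmxBl.
have mxB (A B : 'M[C]_1) : (A - B) 0 0 = A 0 0 - B 0 0 by rewrite !mxE.
rewrite mxB.
by case: ((v *m N *m _) 0 0) => a b; case: ((v *m N' *m _) 0 0).
Qed.

Lemma qf_rdiag n (l : 'I_n -> R) v : qf (rdiag l) v = \sum_i l i * nsq (v 0 i).
Proof.
rewrite /qf mxE Re_sum; apply: eq_bigr => i _.
rewrite mul_mx_diag !mxE mulrAC mulrC nsq_mulCJ -rmorphM /=.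
by rewrite mulrC.
Qed.

Lemma qf1 n (v : 'rV[C]_n) : qf 1%:M v = \sum_i nsq (v 0 i).
Proof. by rewrite -rdiag1 qf_rdiag; apply: eq_bigr => i _; rewrite mul1r. Qed.

Lemma qf_scalar n (c : R) (v : 'rV[C]_n) : qf (c%:C)%:M v = c * qf 1%:M v.
Proof. by rewrite -rdiag_const qf_rdiag qf1 mulr_sumr. Qed.

Lemma qf_scale n (c : R) (l : 'I_n -> R) (v : 'rV[C]_n) :
  qf (rdiag (fun i => c * l i)) v = c * qf (rdiag l) v.
Proof. by rewrite !qf_rdiag mulr_sumr; apply: eq_bigr => i _; rewrite mulrA. Qed.

Lemma qf1_ge0 n (v : 'rV[C]_n) : 0 <= qf 1%:M v.
Proof. by rewrite qf1 sumr_ge0 // => i _; rewrite nsq_ge0. Qed.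

Lemma qf1_gt0 n (v : 'rV[C]_n) : v != 0 -> 0 < qf 1%:M v.
Proof.
move=> v0; rewrite lt_def qf1_ge0 andbT; apply: contraNneq v0 => /eqP.
rewrite qf1 psumr_eq0 => [|i _]; last exact: nsq_ge0.
move=> /allP v0; apply/eqP/rowP => i; rewrite mxE; apply/eqP; rewrite -nsq_eq0.
by apply: (v0 i); rewrite mem_index_enum.
Qed.

Lemma hev_char_poly n m (N : 'M[C]_n) (M : 'M[C]_m) :
  char_poly N = char_poly M -> hev N = hev M.
Proof. by rewrite hev.unlock => ->. Qed.

(** Unitary similarity preserves the characteristic polynomial, and a factorization into linear
    factors is unique up to order. *)
Lemma hev_diagonalized n (U N : 'M[C]_n) (l : 'I_n -> R) :
  U *m U^t* = 1%:M -> N = U^t* *m rdiag l *m U -> hev N = sort >=%R (codom l).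
Proof.
move=> UU ->; rewrite hev.unlock char_poly_similar //; last exact: mulmx1C.
case: closed_field_poly_normal => r /= rE.
have : char_poly (rdiag l) = \prod_(z <- [seq (l i)%:C | i <- enum 'I_n]) ('X - z%:P).
  rewrite char_poly_trig ?diag_mx_is_trig // big_map big_enum /=.
  by apply: eq_bigr => i _; rewrite !mxE eqxx.
rewrite [in LHS]rE (monicP (char_poly_monic _)) scale1r => /prod_XsubC_eq pe.
apply/perm_sortP.
- by move=> a b; exact: le_total.
- by move=> a b c ab bc; exact: le_trans bc ab.
- by move=> a b /andP[ab ba]; apply/eqP; rewrite eq_le; apply/andP.
by have := perm_map (@complex.Re R) pe; rewrite -map_comp.
Qed.

(** The spectral theorem with ordered eigenvalues: the permutation that sorts them is absorbed into
    the unitary matrix, so that row [i] of [U] belongs to the [i]-th entry of [hev N]. *)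
Lemma hev_spectral n (N : 'M[C]_n) : N^t* = N ->
  exists2 U : 'M[C]_n, U *m U^t* = 1%:M &
    N = U^t* *m rdiag (fun i => (hev N)`_i) *m U.
Proof.
move=> NN.
have Nh : N \is hermsymmx by apply/is_hermitianmxP; rewrite expr0 scale1r NN.
have /orthomx_spectralP := hermitian_normalmx Nh.
have Uu := spectral_unitarymx N; rewrite (invmx_unitary Uu).
have /mxOverP Dr := hermitian_spectral_diag_real Nh.
move: Uu => /unitarymxP; set U := spectralmx N; set D := spectral_diag N => UU NE.
pose l i := complex.Re (D 0 i).
have DE : diag_mx D = rdiag l.
  by congr diag_mx; apply/rowP => i; rewrite mxE RRe_real.
rewrite DE in NE.
have [s [sE _]] := sort_codom_perm l.
have hE (i : 'I_n) : (hev N)`_i = l (s i).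
  rewrite (hev_diagonalized UU NE) sE (nth_map i) ?size_enum_ord //.
  by rewrite nth_ord_enum.
exists (perm_mx s *m U).
  rewrite adjM mulmxA -[_ *m U *m _]mulmxA UU mulmx1 tr_perm_mx map_perm_mx.
  by rewrite -perm_mxM mulgV perm_mx1.
rewrite {1}NE adjM tr_perm_mx map_perm_mx !mulmxA; congr (_ *m _).
rewrite -!mulmxA; congr (_ *m _); rewrite mulmxA.
apply/matrixP => i j; rewrite -row_permE.
have -> : perm_mx s = perm_mx (s^-1)^-1%g :> 'M[C]_n by rewrite invgK.
rewrite -col_permE !mxE.
rewrite (inj_eq perm_inj).
by case: eqP => //= ij; rewrite hE permKV.
Qed.

Lemma size_hev n (N : 'M[C]_n) : size (hev N) = n.
Proof.
rewrite hev.unlock size_sort size_map; case: closed_field_poly_normal => r /= rE.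
have := size_char_poly N; rewrite rE (monicP (char_poly_monic _)) scale1r.
by rewrite size_prod_XsubC => -[].
Qed.

Lemma hev_sorted n (N : 'M[C]_n) : sorted >=%R (hev N).
Proof. by rewrite hev.unlock; apply: sort_sorted => a b; exact: le_total. Qed.

Lemma hev_dec n (N : 'M[C]_n) i j : (i <= j)%N -> (j < n)%N -> (hev N)`_j <= (hev N)`_i.
Proof. by move=> ij jn; rewrite sorted_ler_nth ?hev_sorted ?size_hev. Qed.

Lemma hev_unique n (U N : 'M[C]_n) (l : 'I_n -> R) :
  U *m U^t* = 1%:M -> N = U^t* *m rdiag l *m U ->
  (forall i j : 'I_n, (i <= j)%N -> l j <= l i) ->
  forall i : 'I_n, (hev N)`_i = l i.
Proof.
move=> UU NE ldec i.
by rewrite (hev_diagonalized UU NE) -(decreasing_rearr_id i ldec).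
Qed.

Lemma sum_hev n (N : 'M[C]_n) : N^t* = N ->
  \sum_(i < n) (hev N)`_i = complex.Re (\tr N).
Proof.
move=> NN; have [U UU NE] := hev_spectral NN.
rewrite [in RHS]NE mxtrace_mulC mulmxA UU mul1mx mxtrace_diag Re_sum.
by apply: eq_bigr => i _; rewrite mxE.
Qed.

Lemma det_unitary_congr n (U D : 'M[C]_n) : U *m U^t* = 1%:M ->
  \det (U^t* *m D *m U) = \det D.
Proof.
by move=> UU; rewrite !det_mulmx mulrAC -det_mulmx (mulmx1C UU) det1 mul1r.
Qed.

Lemma prod_hev n (N : 'M[C]_n) : N^t* = N ->
  (\prod_(i < n) (hev N)`_i)%:C = \det N.
Proof.
move=> NN; have [U UU NE] := hev_spectral NN.
rewrite [in RHS]NE (det_unitary_congr _ UU).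
by rewrite det_diag rmorph_prod; apply: eq_bigr => i _; rewrite mxE.
Qed.

Lemma qf_spectral n (U N : 'M[C]_n) (l : 'I_n -> R) v :
  N = U^t* *m rdiag l *m U -> qf N v = \sum_i l i * nsq ((v *m U^t*) 0 i).
Proof. by move=> ->; rewrite -qf_rdiag qf_mul trmxCK. Qed.

Lemma qf1_unitary n m (U : 'M[C]_(m, n)) v :
  U *m U^t* = 1%:M -> qf 1%:M (v *m U) = qf 1%:M v.
Proof. by move=> UU; rewrite qf_mul mulmx1 UU. Qed.

(* The easy half of Courant-Fischer: [V] maps isomorphically onto a subspace
   of dimension [j.+1], which meets the span of the last [d - j] eigenvectors. *)
Lemma hev_ge n (N : 'M[C]_n) j (V : 'M[C]_(j.+1, n)) (c : R) : N^t* = N ->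
  (forall u : 'rV_j.+1, u != 0 -> 0 < qf 1%:M (u *m V)) ->
  (forall u : 'rV_j.+1, c * qf 1%:M (u *m V) <= qf N (u *m V)) ->
  (j < n)%N -> c <= (hev N)`_j.
Proof.
move=> NN Vinj cN jn; have [U UU NE] := hev_spectral NN.
have UU' := mulmx1C UU.
(* Right multiplication by [E] keeps the first [j] coordinates; a matrix with [j.+1] rows and [j]
   columns has a nonzero left kernel vector [u]. *)
pose E : 'M[C]_(n, j) := \matrix_(a, b) ((a : nat) == b)%:R.
have [u u0 uE] : exists2 u : 'rV[C]_j.+1, u != 0 & u *m (V *m U^t* *m E) = 0.
  set K := V *m U^t* *m E.
  have Kn0 : kermx K != 0.
    by rewrite kermx_eq0 /row_free neq_ltn ltnS rank_leq_col.
  have [i ri] : exists i, row i (kermx K) != 0.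
    by apply/existsP; apply: contraNT Kn0 => /existsPn H; apply/eqP/row_matrixP
      => i; rewrite row0; apply/eqP; have := H i; rewrite negbK.
  by exists (row i (kermx K)) => //; rewrite -row_mul mulmx_ker row0.
have w0 (a : 'I_n) : (a < j)%N -> (u *m V *m U^t*) 0 a = 0.
  move=> aj; have /rowP/(_ (Ordinal aj)) := uE.
  rewrite !mulmxA mxE [RHS]mxE (bigD1 a) //= [E a _]mxE eqxx mulr1 big1 ?addr0 // => b ba.
  by rewrite [E _ _]mxE (negbTE (_ : (b : nat) != a)) ?mulr0.
have qn : qf 1%:M (u *m V) = \sum_i nsq ((u *m V *m U^t*) 0 i).
  by rewrite -qf1 [in RHS]qf1_unitary ?trmxCK.
rewrite -(ler_pM2r (Vinj u u0)); apply: le_trans (cN u) _.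
rewrite (qf_spectral _ NE) qn mulr_sumr; apply: ler_sum => i _.
have [ij|ji] := ltnP i j; first by rewrite w0 // (_ : nsq 0 = 0) ?mulr0 //; apply/eqP; rewrite nsq_eq0.
by rewrite ler_wpM2r ?nsq_ge0 ?hev_dec.
Qed.

Lemma qf1_pid n j (u : 'rV[C]_j.+1) : (j < n)%N ->
  qf 1%:M (u *m (pid_mx j.+1 : 'M[C]_(j.+1, n))) = qf 1%:M u.
Proof.
move=> jn; rewrite qf1_unitary // tr_pid_mx map_pid_mx mul_pid_mx minnn.
by rewrite (minn_idPr _) // pid_mx_1.
Qed.

(** [pid_mx j.+1] embeds [u] in the first [j.+1] coordinates; the remaining ones vanish, so the
    diagonals need not be compared there. *)
Lemma qf_pid_le n j (l l' : 'I_n -> R) (u : 'rV[C]_j.+1)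
    (w := u *m (pid_mx j.+1 : 'M[C]_(j.+1, n))) :
  (forall i : 'I_n, (i <= j)%N -> l i <= l' i) -> qf (rdiag l) w <= qf (rdiag l') w.
Proof.
move=> ll'; rewrite !qf_rdiag; apply: ler_sum => i _.
have [ij|ji] := leqP i j; first by rewrite ler_wpM2r ?nsq_ge0 ?ll'.
suff -> : w 0 i = 0.
  by rewrite (_ : nsq 0 = 0) ?mulr0 //; apply/eqP; rewrite nsq_eq0.
rewrite mxE big1 // => k _; rewrite mxE.
case: eqP => //= ki; last by rewrite mulr0.
by have := ltn_ord k; rewrite ki ltnS leqNgt ji.
Qed.

(** The image under the isometry [T] of the leading [j.+1] eigenvectors of [N] serves as test space
    for [hev_ge]. Monotonicity of the eigenvalues is the case where [T] is the identity, and Cauchy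
    interlacing the case where [N] is a compression of [N']. *)
Lemma hev_le_isometry n m (N : 'M[C]_n) (N' : 'M[C]_m) (T : 'M[C]_(n, m)) j :
  N^t* = N -> N'^t* = N' -> T *m T^t* = 1%:M ->
  (forall v, qf N v <= qf N' (v *m T)) -> (j < n)%N -> (hev N)`_j <= (hev N')`_j.
Proof.
move=> NN NN' TT le_N jn; have [U UU NE] := hev_spectral NN.
pose V := (pid_mx j.+1 : 'M[C]_(j.+1, n)) *m U *m T.
have Vn u : qf 1%:M (u *m V) = qf 1%:M u by rewrite !mulmxA (qf1_unitary _ TT) (qf1_unitary _ UU) qf1_pid.
apply: (@hev_ge _ _ _ V) => //.
- by move=> u u0; rewrite Vn qf1_gt0.
- move=> u; rewrite !mulmxA; apply: le_trans (le_N _).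
  rewrite (qf1_unitary _ TT) (qf1_unitary _ UU) [in leRHS]NE [leRHS]qf_mul.
  rewrite -!mulmxA UU mulmx1 !mulmxA UU mul1mx.
  rewrite -qf_scalar -rdiag_const.
  by apply: qf_pid_le => i ij; rewrite hev_dec.
- by rewrite (leq_trans jn) // (mulmx1_min TT).
Qed.

Lemma hev_le n (N N' : 'M[C]_n) (j : 'I_n) : N^t* = N -> N'^t* = N' ->
  (forall v, qf N v <= qf N' v) -> (hev N)`_j <= (hev N')`_j.
Proof.
move=> NN NN' le_N; apply: (@hev_le_isometry _ _ _ _ 1%:M) => //.
  by rewrite trmx1 map_mx1 mulmx1.
by move=> v; rewrite mulmx1.
Qed.

Lemma hev_rdiag n (l : 'I_n -> R) :
  (forall i j : 'I_n, (i <= j)%N -> l j <= l i) ->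
  forall i : 'I_n, (hev (rdiag l))`_i = l i.
Proof.
move=> ldec; apply: (@hev_unique _ 1%:M) => //.
  by rewrite trmx1 map_mx1 mulmx1.
by rewrite trmx1 map_mx1 mulmx1 mul1mx.
Qed.

Lemma hev_ge_const n (N : 'M[C]_n) (c : R) (j : 'I_n) : N^t* = N ->
  (forall v, c * qf 1%:M v <= qf N v) -> c <= (hev N)`_j.
Proof.
move=> NN H; have <- : (hev (rdiag (fun _ : 'I_n => c)))`_j = c by apply: hev_rdiag.
by apply: hev_le; rewrite ?adj_rdiag // => v; rewrite rdiag_const qf_scalar.
Qed.

Lemma hev_le_const n (N : 'M[C]_n) (c : R) (j : 'I_n) : N^t* = N ->
  (forall v, qf N v <= c * qf 1%:M v) -> (hev N)`_j <= c.
Proof.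
move=> NN H; have <- : (hev (rdiag (fun _ : 'I_n => c)))`_j = c by apply: hev_rdiag.
by apply: hev_le; rewrite ?adj_rdiag // => v; rewrite rdiag_const qf_scalar.
Qed.

(** For [n = 0] both forms vanish, so the default value 0 of [last] is harmless. *)
Lemma qf_ge_last n (N : 'M[C]_n) v : N^t* = N ->
  last 0 (hev N) * qf 1%:M v <= qf N v.
Proof.
move=> NN; have [U UU NE] := hev_spectral NN.
have -> : qf 1%:M v = \sum_i nsq ((v *m U^t*) 0 i).
  by rewrite -qf1 [in RHS]qf1_unitary // trmxCK mulmx1C.
rewrite (qf_spectral _ NE) mulr_sumr; apply: ler_sum => i _.
rewrite ler_wpM2r ?nsq_ge0 // -nth_last size_hev.
have nK := ltn_predK (ltn_ord i).
by apply: hev_dec; [rewrite -ltnS nK | rewrite -{2}nK].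
Qed.

End Hermitian.

(** * Inequalities for sums weighted by nonincreasing vectors *)

Section OrdinalSums.
Variable R : realType.

Lemma abel_sum_ord_ge0 (n : nat) (w d : 'I_n -> R) :
  (forall i j : 'I_n, (i <= j)%N -> w j <= w i) -> (forall i, 0 <= w i) ->
  (forall m, (m <= n)%N -> 0 <= \sum_(i < n | (i < m)%N) d i) ->
  0 <= \sum_(i < n) w i * d i.
Proof.
move=> wdec w0 d0.
(* Vectors are extended by 0 to functions on [nat]. *)
pose ext (f : 'I_n -> R) m := oapp f 0 (insub m).
have extE f (i : 'I_n) : ext f i = f i by rewrite /ext valK.
under eq_bigr do rewrite -(extE w) -(extE d).
have extO f m (mn : (m < n)%N) : ext f m = f (Ordinal mn) by rewrite -extE.
apply: (abel_sum_ge0 (w := ext w) (d := ext d)).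
- by move=> i lt_in; rewrite !extO ?(ltnW lt_in) //= => lt_in'; rewrite wdec.
- by move=> i lt_in; rewrite extO.
- move=> m mn; rewrite (big_ord_widen n) //.
  by under eq_bigr do rewrite extE; exact: d0.
Qed.

Lemma card_ord_lt n m : (m <= n)%N -> #|[pred i : 'I_n | (i < m)%N]| = m.
Proof.
move=> mn; rewrite -sum1_card (eq_bigl (fun i : 'I_n => (i < m)%N)) //.
by rewrite -(big_ord_widen n (fun=> 1%N)) // sum_nat_const card_ord muln1.
Qed.

(* von Neumann's trace inequality, in terms of a doubly stochastic matrix. *)
Lemma doubly_stochastic_sum_le n (W : 'I_n -> 'I_n -> R) (a t : 'I_n -> R) :
  (forall i j, 0 <= W i j) ->
  (forall i, \sum_j W i j = 1) -> (forall j, \sum_i W i j = 1) ->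
  (forall i j : 'I_n, (i <= j)%N -> a j <= a i) -> (forall i, 0 <= a i) ->
  (forall i j : 'I_n, (i <= j)%N -> t j <= t i) -> (forall i, 0 <= t i) ->
  \sum_i t i * (\sum_j a j * W i j) <= \sum_i t i * a i.
Proof.
move=> W0 Wr Wc adec a0 tdec t0; rewrite -subr_ge0 -sumrB.
under eq_bigr do rewrite -mulrBr.
(* Abel summation in [t], then another in [a] below, leave the claim that a block of [k] rows and
   [l] columns of [W] has sum at most the minimum of [k] and [l]. *)
apply: abel_sum_ord_ge0 => // k kn.
rewrite sumrB exchange_big /= [X in X - _]big_mkcond /= -sumrB.
rewrite (eq_bigr (fun j : 'I_n =>
    a j * ((if (j < k)%N then 1 else 0) - \sum_(i < n | (i < k)%N) W i j))).
  2: by move=> j _; rewrite mulrBr mulr_sumr; case: ifP; rewrite ?mulr1 ?mulr0.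
apply: abel_sum_ord_ge0 => // l ln; rewrite sumrB -big_mkcondr /= subr_ge0.
have le_row i (P : pred 'I_n) : \sum_(j | P j) W i j <= 1.
  by rewrite -(Wr i) big_mkcond ler_sum // => j _; case: ifP.
have le_col j (P : pred 'I_n) : \sum_(i | P i) W i j <= 1.
  by rewrite -(Wc j) big_mkcond ler_sum // => i _; case: ifP.
(* The block is summed by columns if [l <= k], and by rows otherwise. *)
have [lk|/ltnW kl] := leqP l k.
  rewrite [leRHS](eq_bigl (fun j : 'I_n => (j < l)%N)) ?ler_sum // => j.
  by case: ltnP => //= jl; rewrite (leq_trans jl).
rewrite exchange_big /=.
rewrite [leRHS](eq_bigl (fun j : 'I_n => (j < k)%N)) ?ler_sum // => j.
by rewrite andbC; case: ltnP => //= jk; rewrite (leq_trans jk).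
Qed.

(** Both sums have [#|J|] terms, so the threshold [t], the last of the initial values, may be
    subtracted from every term; initial terms become nonnegative and all others nonpositive. *)
Lemma sum_set_le_initial n (a : 'I_n -> R) (J : {set 'I_n}) :
  (forall i j : 'I_n, (i <= j)%N -> a j <= a i) ->
  \sum_(i in J) a i <= \sum_(i < n | (i < #|J|)%N) a i.
Proof.
move=> adec; have [->|/set0Pn[j0 j0J]] := eqVneq J set0.
  by rewrite big_set0 cards0 big_pred0.
have Jn : (#|J| <= n)%N by rewrite -[leqRHS]card_ord max_card.
have J0 : (0 < #|J|)%N by rewrite card_gt0; apply/set0Pn; exists j0.
have kn : (#|J|.-1 < n)%N by rewrite prednK.
pose t := a (Ordinal kn).
rewrite -(lerD2r (- (\sum_(i in J) t))) -sumrB.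
have -> : \sum_(i in J) t = \sum_(i < n | (i < #|J|)%N) t.
  by rewrite !sumr_const card_ord_lt.
rewrite -sumrB big_mkcond [leRHS]big_mkcond; apply: ler_sum => i _.
case: ifP => _; case: ltnP => //= iJ; rewrite ?subr_le0 ?subr_ge0.
- by apply: adec => /=; rewrite (leq_trans (leq_pred _)).
- by apply: adec => /=; rewrite -ltnS prednK.
Qed.

End OrdinalSums.

(** * Eigenvalues of a weighted contraction compared with the weights *)

Section Core.
Local Open Scope sesquilinear_scope.
Local Open Scope complex_scope.
Variables (R : realType) (p : nat).
Local Notation C := R[i].
Variables (a : 'I_p -> R) (K : 'M[C]_p).
Hypothesis adec : forall i j : 'I_p, (i <= j)%N -> a j <= a i.
Hypothesis a0 : forall i, 0 <= a i.
Hypothesis KK : K^t* = K.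
Hypothesis K0 : forall v, 0 <= qf K v.
Hypothesis K1 : forall v, qf K v <= qf 1%:M v.

(** [h] is the square root of [diag(a)], and [c] lists the eigenvalues of [K] in increasing order,
    as squared cosines of decreasing angles. *)
Let h := rdiag (fun i => Num.sqrt (a i)).
Let g (i : 'I_p) := (hev (h *m K *m h))`_i.
Let c (i : 'I_p) := (hev K)`_(rev_ord i).

Lemma adj_sqrt_weight : h^t* = h. Proof. exact: adj_rdiag. Qed.

Lemma hermitian_weighted (N : 'M[C]_p) : N^t* = N -> (h *m N *m h)^t* = h *m N *m h.
Proof. by move=> NN; rewrite -{2 4}adj_sqrt_weight hermitian_congr. Qed.

Lemma qf_weighted (N : 'M[C]_p) v : qf (h *m N *m h) v = qf N (v *m h).
Proof. by rewrite qf_mul adj_sqrt_weight. Qed.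

Lemma rdiag_sqrtM : h *m h = rdiag a.
Proof. by rewrite rdiagM; apply: eq_rdiag => i; rewrite -expr2 sqr_sqrtr. Qed.

Lemma qf1_weighted v : qf 1%:M (v *m h) = qf (rdiag a) v.
Proof. by rewrite -qf_weighted mulmx1 rdiag_sqrtM. Qed.

Lemma hev_rev_inc (i j : 'I_p) : (i <= j)%N -> c i <= c j.
Proof. by move=> ij; apply: hev_dec; [exact: leq_sub2l | exact: ltn_ord]. Qed.

Lemma hev_rev_ge0 i : 0 <= c i.
Proof. by apply: hev_ge_const => // v; rewrite mul0r. Qed.

Lemma hev_rev_le1 i : c i <= 1.
Proof. by apply: hev_le_const => // v; rewrite mul1r. Qed.

(** The product of the least eigenvalue [c z] of [K] and the least weight [a l] bounds the form of
    [h *m K *m h] from below on unit vectors. *)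
Lemma hev_weighted_gt0 : (forall i, 0 < a i) -> (forall i, 0 < c i) -> forall i, 0 < g i.
Proof.
move=> a_gt0 c_gt0 i0; have p0 : (0 < p)%N := leq_ltn_trans (leq0n _) (ltn_ord i0).
have lp : (p.-1 < p)%N by rewrite prednK.
pose l := Ordinal lp; pose z := Ordinal p0.
apply: lt_le_trans (_ : c z * a l <= _); first by rewrite mulr_gt0.
apply: hev_ge_const; first exact: hermitian_weighted.
move=> v; rewrite qf_weighted; apply: le_trans (_ : c z * qf 1%:M (v *m h) <= _).
  rewrite -mulrA qf1_weighted ler_wpM2l ?hev_rev_ge0 //.
  rewrite -qf_scalar -rdiag_const !qf_rdiag; apply: ler_sum => i _.
  by rewrite ler_wpM2r ?nsq_ge0 // adec //= -ltnS prednK.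
have [U UU KE] := hev_spectral KK.
have -> : qf 1%:M (v *m h) = \sum_i nsq ((v *m h *m U^t*) 0 i).
  by rewrite -qf1 [in RHS]qf1_unitary // trmxCK mulmx1C.
rewrite (qf_spectral _ KE) mulr_sumr; apply: ler_sum => i _.
by rewrite ler_wpM2r ?nsq_ge0 // -[i in leRHS]rev_ordK hev_rev_inc.
Qed.

(** The trace is the sum of the [t i * a j] weighted by the squared moduli of the entries of [U],
    which form a doubly stochastic matrix. As [t] increases while [a] decreases, [t] is reversed. *)
Lemma trace_weighted_le (U : 'M[C]_p) (t : 'I_p -> R) : U *m U^t* = 1%:M ->
  (forall i j : 'I_p, (i <= j)%N -> t i <= t j) -> (forall i, 0 <= t i) ->
  complex.Re (\tr (h *m (U^t* *m rdiag t *m U) *m h)) <=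
    \sum_i t (rev_ord i) * a i.
Proof.
move=> UU tinc t0.
have UU' := mulmx1C UU.
have nsqC z : nsq (Num.conj z) = nsq z :> R by case: z => x y; rewrite /nsq /= sqrrN.
have -> : complex.Re (\tr (h *m (U^t* *m rdiag t *m U) *m h)) =
    \sum_i t (rev_ord i) * \sum_j a j * nsq (U (rev_ord i) j).
  rewrite mxtrace_mulC mulmxA rdiag_sqrtM !mulmxA mxtrace_mulC !mulmxA.
  rewrite [LHS]Re_sum [LHS](reindex_inj rev_ord_inj); apply: eq_bigr => i _ /=.
  rewrite mul_mx_diag mxE mxE mulrC.
  rewrite [(\row__ _) 0 _]mxE Re_mul_realC; congr (_ * _).
  rewrite Re_sum; apply: eq_bigr => j _.
  rewrite mul_mx_diag !mxE mulrAC mulrC nsq_mulCJ Re_mul_realC //.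
have row1 i : \sum_j nsq (U i j) = 1.
  have /matrixP/(_ i i) := UU; rewrite !mxE eqxx => /(congr1 (@complex.Re R)) E.
  rewrite -[RHS]/(complex.Re (true%:R : C)) -E Re_sum.
  by apply: eq_bigr => j _; rewrite !mxE nsq_mulCJ.
have col1 j : \sum_i nsq (U i j) = 1.
  have /matrixP/(_ j j) := UU'; rewrite !mxE eqxx => /(congr1 (@complex.Re R)) E.
  rewrite -[RHS]/(complex.Re (true%:R : C)) -E Re_sum.
  by apply: eq_bigr => i _; rewrite !mxE mulrC nsq_mulCJ.
apply: (@doubly_stochastic_sum_le _ _ (fun i j => nsq (U (rev_ord i) j))) => //.
- by move=> *; exact: nsq_ge0.
- by move=> j; rewrite -[RHS](col1 j) [RHS](reindex_inj rev_ord_inj).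
- by move=> i j ij; apply: tinc; exact: leq_sub2l.
Qed.

(* Li and Mathias: truncating [1 - K] at its [#|J|]-th eigenvalue makes every
   eigenvalue gap nonnegative, so that the sum over [J] is at most a trace. *)
Lemma sum_gap_le (J : {set 'I_p}) : (0 < #|J|)%N ->
  \sum_(i in J) (a i - g i) <= \sum_(i < p | (i < #|J|)%N) a i * (1 - c i).
Proof.
move=> J0; have Jp : (#|J| <= p)%N by rewrite -[leqRHS]card_ord max_card.
have kp : (#|J|.-1 < p)%N by rewrite prednK.
(* With [k = #|J|], this is the [k]-th largest eigenvalue of [1 - K]; the index is [k.-1] because
   counting starts at 0. *)
pose t := 1 - c (Ordinal kp).
have t0 : 0 <= t by rewrite subr_ge0 hev_rev_le1.
have t1 : 0 <= 1 - t by rewrite opprB addrC subrK hev_rev_ge0.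
have [U UU KE] := hev_spectral KK.
have UU' := mulmx1C UU.
(* [T] is the positive part of [1 - K - t]. Hence [S] below has the eigenvalues of [K] cut off above
   at [1 - t]: it is dominated both by [K], whence [dg], and by [1 - t], whence [da]. *)
pose tau (i : 'I_p) := Num.max (1 - (hev K)`_i - t) 0.
pose T := U^t* *m rdiag tau *m U.
have T0 v : 0 <= qf T v.
  rewrite (qf_spectral _ (erefl T)) sumr_ge0 // => i _.
  by rewrite mulr_ge0 ?nsq_ge0 // le_max lexx orbT.
have TT : T^t* = T by exact: hermitian_unitary_congr.
pose S := ((1 - t)%:C)%:M - T.
have SS : S^t* = S by rewrite adjB adj_scalar TT.
pose d (i : 'I_p) := (hev (h *m S *m h))`_i.
have dg i : d i <= g i.
  apply: hev_le; [exact: hermitian_weighted | exact: hermitian_weighted | move=> v].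
  rewrite !qf_weighted qfB qf_scalar (qf_spectral _ KE) (qf_spectral _ (erefl T)).
  have -> : qf 1%:M (v *m h) = \sum_i nsq ((v *m h *m U^t*) 0 i).
    by rewrite -qf1 [in RHS]qf1_unitary // trmxCK.
  rewrite mulr_sumr -sumrB; apply: ler_sum => j _; rewrite -mulrBl.
  rewrite ler_wpM2r ?nsq_ge0 // lerBlDr -lerBlDl.
  by rewrite le_max; apply/orP; left; lra.
have da i : d i <= (1 - t) * a i.
  have <- : (hev (rdiag (fun i => (1 - t) * a i)))`_i = (1 - t) * a i.
    by apply: hev_rdiag => x y xy; rewrite ler_wpM2l ?adec.
  apply: hev_le; [exact: hermitian_weighted | exact: adj_rdiag | move=> v].
  rewrite qf_weighted qfB qf_scalar qf1_weighted.
  rewrite qf_scale.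
  by rewrite lerBlDr lerDl T0.
have sumd : \sum_i ((1 - t) * a i - d i) = complex.Re (\tr (h *m T *m h)).
  rewrite sumrB sum_hev; last exact: hermitian_weighted.
  rewrite mulmxBr mulmxBl.
  rewrite mul_mx_scalar -scalemxAl rdiag_sqrtM linearB /= mxtraceZ mxtrace_diag.
  have ReB (x y : C) : complex.Re (x - y) = complex.Re x - complex.Re y.
    by case: x y => ? ? [].
  rewrite ReB Re_mul_realC Re_sum mulr_sumr.
  rewrite [X in _ - (X - _)](eq_bigr (fun i => (1 - t) * a i)).
    by lra.
  by move=> i _; rewrite mxE.
have tauinc (i j : 'I_p) : (i <= j)%N -> tau i <= tau j.
  move=> ij; rewrite /tau ge_max !le_max lexx orbT andbT.
  by have := hev_dec K ij (ltn_ord j) => cij; apply/orP; left; lra.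
have tau0 i : 0 <= tau i by rewrite le_max lexx orbT.
have tr_le := trace_weighted_le UU tauinc tau0.
(* Only the [#|J|] smallest eigenvalues of [K] can contribute to the positive part. *)
have tauE : \sum_i tau (rev_ord i) * a i = \sum_(i < p | (i < #|J|)%N) (1 - c i - t) * a i.
  rewrite [RHS]big_mkcond; apply: eq_bigr => i _.
  rewrite /tau -/(c i); case: ltnP => iJ.
    rewrite max_l // subr_ge0 lerD2l lerN2 hev_rev_inc //=.
    by rewrite -ltnS prednK.
  rewrite max_r ?mul0r // subr_le0 lerD2l lerN2 hev_rev_inc //=.
  by rewrite (leq_trans (leq_pred _)).
apply: le_trans (_ : \sum_(i in J) (t * a i + ((1 - t) * a i - d i)) <= _).
  by apply: ler_sum => i _; have := dg i; lra.
rewrite big_split /= -mulr_sumr.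
(* The sum of the [a i] moves from [J] to the initial indices, while the gaps, nonnegative by [da],
   are summed over all indices to give the trace. *)
apply: le_trans (_ : t * (\sum_(i < p | (i < #|J|)%N) a i) +
   \sum_i tau (rev_ord i) * a i <= _).
  apply: lerD; first by rewrite ler_wpM2l ?sum_set_le_initial.
  apply: le_trans tr_le; rewrite -/T -sumd big_mkcond; apply: ler_sum => i _.
  by case: ifP => // _; rewrite subr_ge0.
rewrite tauE mulr_sumr -big_split /=; apply: ler_sum => i _; lra.
Qed.

Lemma ln_prod (f : 'I_p -> R) : (forall i, 0 < f i) ->
  ln (\prod_i f i) = \sum_i ln (f i).
Proof.
move=> f0; suff [] : 0 < \prod_i f i /\ ln (\prod_i f i) = \sum_i ln (f i) by [].
apply: (big_ind2 (fun x y => 0 < x /\ ln x = y)); first by rewrite ln1.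
  by move=> x1 y1 x2 y2 [x10 <-] [x20 <-]; rewrite mulr_gt0 // lnM.
by move=> i _; split.
Qed.

(** Here [z] stands for a truncated eigenvalue with [z <= t * x]: the inserted factor [t] makes
    [ln (t * x) - ln z] nonnegative, and its logarithm is taken off again. *)
Lemma ln_ratio_le (x y z t : R) : 0 < x -> 0 < y -> 0 < t -> z <= y -> 0 < z ->
  ln (x / y) <= ln (t * x) - ln z - ln t.
Proof.
move=> x0 y0 t0 zy z0; have : ln z <= ln y by rewrite ler_ln ?posrE.
by rewrite ln_div ?posrE // lnM ?posrE //; lra.
Qed.

(* The multiplicative counterpart of [sum_gap_le]: [K] is truncated from above
   at its [#|J|]-th smallest eigenvalue and the trace becomes a determinant. *)
Lemma sum_ln_ratio_le (J : {set 'I_p}) : (0 < #|J|)%N ->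
  (forall i, 0 < a i) -> (forall i, 0 < c i) ->
  \sum_(i in J) ln (a i / g i) <= \sum_(i < p | (i < #|J|)%N) ln (c i)^-1.
Proof.
move=> J0 a_gt0 c_gt0; have Jp : (#|J| <= p)%N by rewrite -[leqRHS]card_ord max_card.
have kp : (#|J|.-1 < p)%N by rewrite prednK.
have [t tE] : exists t, t = c (Ordinal kp) by eexists.
have t0 : 0 < t by rewrite tE.
have [U UU KE] := hev_spectral KK.
have UU' := mulmx1C UU.
pose tau (i : 'I_p) := Num.min (hev K)`_i t.
pose T := U^t* *m rdiag tau *m U.
have TT : T^t* = T by exact: hermitian_unitary_congr.
pose hTh := h *m T *m h.
have hThh : hTh^t* = hTh by exact: hermitian_weighted.
pose d (i : 'I_p) := (hev hTh)`_i.
have tau_gt0 i : 0 < tau i.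
  by rewrite lt_min t0 andbT -[i in ltRHS]rev_ordK c_gt0.
have dg i : d i <= g i.
  apply: hev_le; [exact: hThh | exact: hermitian_weighted | move=> v].
  rewrite !qf_weighted (qf_spectral _ KE) (qf_spectral _ (erefl T)).
  by apply: ler_sum => j _; rewrite ler_wpM2r ?nsq_ge0 // ge_min lexx.
have da i : d i <= t * a i.
  have <- : (hev (rdiag (fun i => t * a i)))`_i = t * a i.
    by apply: hev_rdiag => x y xy; rewrite ler_pM2l ?adec.
  apply: hev_le; [exact: hThh | exact: adj_rdiag | move=> v].
  rewrite qf_scale.
  have E : qf 1%:M (v *m h) = \sum_i nsq ((v *m h *m U^t*) 0 i).
    by rewrite -qf1 [in RHS]qf1_unitary // trmxCK.
  rewrite qf_weighted -qf1_weighted E (qf_spectral _ (erefl T)) mulr_sumr.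
  by apply: ler_sum => j _; rewrite ler_wpM2r ?nsq_ge0 // ge_min lexx orbT.
(* The product of the eigenvalues is a determinant, which is multiplicative: that of [h *m h] gives
   the [a i], that of [T] the [tau i]. *)
have prodd : \prod_i d i = (\prod_i a i) * \prod_i tau i.
  apply: (@complexI R); rewrite prod_hev // det_mulmx det_mulmx.
  rewrite (det_unitary_congr _ UU) mulrAC -det_mulmx rdiag_sqrtM.
  rewrite !det_diag rmorphM !rmorph_prod.
  by congr (_ * _); apply: eq_bigr => i _; rewrite mxE.
have d_ge0 i : 0 <= d i.
  apply: hev_ge_const; first exact: hThh.
  move=> v; rewrite mul0r qf_weighted (qf_spectral _ (erefl T)).
  by apply: sumr_ge0 => j _; rewrite mulr_ge0 ?nsq_ge0 // ltW.
(* The [d i] are nonnegative and their product is positive. *)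
have d_gt0 i : 0 < d i.
  rewrite lt_def d_ge0 andbT; apply/negP => /eqP di0.
  have: 0 < \prod_i d i by rewrite prodd mulr_gt0 // prodr_gt0.
  by rewrite (bigD1 i) //= di0 mul0r ltxx.
have g_gt0 := hev_weighted_gt0 a_gt0 c_gt0.
have sumd : \sum_i ln (d i) = \sum_i ln (a i) + \sum_i ln (tau i).
  by rewrite -!ln_prod // prodd lnM // posrE prodr_gt0.
apply: le_trans (_ : \sum_(i in J) (ln (t * a i) - ln (d i) - ln t) <= _).
  by apply: ler_sum => i _; exact: ln_ratio_le.
rewrite sumrB.
(* The terms are nonnegative by [da], so the sum over [J] may be extended to all indices. *)
apply: le_trans (_ : \sum_i (ln (t * a i) - ln (d i)) - \sum_(i in J) ln t <= _).
  rewrite lerD2r big_mkcond; apply: ler_sum => i _; case: ifP => // _.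
  by rewrite subr_ge0 ler_ln ?posrE ?mulr_gt0.
have -> : \sum_i (ln (t * a i) - ln (d i)) = \sum_i (ln t - ln (tau i)).
  rewrite !sumrB sumd opprD addrA; congr (_ - _).
  rewrite -sumrB; apply: eq_bigr => i _; rewrite lnM ?posrE //; lra.
have -> : \sum_(i in J) ln t = \sum_(i < p | (i < #|J|)%N) ln t.
  by rewrite !sumr_const card_ord_lt.
(* In increasing order, [tau] equals [c i] for [i < #|J|], where [ln t] cancels and [- ln (c i)] is
   left, and equals [t] afterwards, where nothing is left. *)
rewrite (reindex_inj rev_ord_inj) /= [X in _ - X]big_mkcond [leRHS]big_mkcond -sumrB.
apply: ler_sum => i _; rewrite /tau -/(c i).
case: ltnP => iJ.
  rewrite min_l; first by rewrite lnV ?posrE //; lra.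
  by rewrite tE hev_rev_inc //= -ltnS prednK.
rewrite min_r ?subrr ?subr0 // tE hev_rev_inc //=.
by rewrite (leq_trans (leq_pred _)).
Qed.

End Core.

(** * Lower bound for the Ritz values when the basis of the invariant subspace consists of
    eigenvectors *)

Lemma affine_le (R : realType) (l x y u w : R) :
  l * (x - y) <= u - w -> l * x + (w - l * y) <= u.
Proof. by move=> H; lra. Qed.

Section Comparison.
Local Open Scope sesquilinear_scope.
Local Open Scope complex_scope.
Variables (R : realType) (n m p q : nat).
Local Notation C := R[i].
Variables (A : 'M[C]_n) (X : 'M[C]_(p, n)) (Y : 'M[C]_(q, n)) (W : 'M[C]_(m, n)).
Hypothesis AA : A^t* = A.
Hypotheses (XX : X *m X^t* = 1%:M) (YY : Y *m Y^t* = 1%:M) (WW : W *m W^t* = 1%:M).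
Hypotheses (XW : X *m W^t* *m W = X) (YW : Y *m W^t* *m W = Y).
Hypothesis pq : (p <= q)%N.
Let lmin := last 0 (hev (W *m A *m W^t*)).

(** The hypothesis places [v] in the row space of [W], which stands for the sum of the two
    subspaces; there the form of [A] is that of its compression. *)
Lemma qf_ge_lmin v : v *m W^t* *m W = v -> lmin * qf 1%:M v <= qf A v.
Proof.
move=> vW; rewrite -vW [in leRHS]qf_mul (qf1_unitary _ WW).
by apply: qf_ge_last; exact: hermitian_congr.
Qed.

Variable a : 'I_p -> R.
Hypothesis XA : X *m A = rdiag a *m X.

(* Since the row space of [X] is invariant, the quadratic form of [A] splits
   along the orthogonal decomposition of [v]. *)
Lemma qf_ge_invariant v : v *m W^t* *m W = v ->
  lmin * qf 1%:M v + qf (rdiag (fun i => a i - lmin)) (v *m X^t*) <= qf A v.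
Proof.
move=> vW; pose P := X^t* *m X.
have AX : A *m X^t* = X^t* *m rdiag a.
  by have := congr1 (fun M => M^t*) XA; rewrite /= !adjM AA adj_rdiag.
have PA : P *m A = X^t* *m rdiag a *m X by rewrite /P -mulmxA XA mulmxA.
have AP : A *m P = X^t* *m rdiag a *m X by rewrite mulmxA AX.
have XP : X *m P = X by rewrite mulmxA XX mul1mx.
have Pa : P^t* = P by rewrite adjM trmxCK.
(* When [N] commutes with the projector [P], the mixed terms vanish. This is used for [A] and for
   the identity. *)
have split (N : 'M[C]_n) (b : 'I_p -> R) : P *m N = X^t* *m rdiag b *m X ->
    N *m P = X^t* *m rdiag b *m X ->
    qf N (v *m (1%:M - P)) = qf N v - qf (rdiag b) (v *m X^t*).
  move=> PN NP; rewrite !qf_mul trmxCK -qfB; congr (qf _ v).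
  rewrite adjB trmx1 map_mx1 Pa mulmxBr mulmx1 mulmxBl mul1mx PN mulmxBl NP.
  by rewrite -[_ *m X *m P]mulmxA XP subrr subr0.
(* The component of [v] orthogonal to the rows of [X] stays in the row space of [W], which contains
   them, so [lmin] bounds the form of [A] there. *)
have := @qf_ge_lmin (v *m (1%:M - P)).
rewrite (split A a) // (split 1%:M (fun=> 1)); first last.
- by rewrite rdiag1 mulmx1 mul1mx.
- by rewrite rdiag1 !mulmx1.
rewrite rdiag1 => H.
have PW : P *m (W^t* *m W) = P by rewrite -mulmxA [X *m _]mulmxA XW.
have {H} := H _; rewrite -rdiagB rdiag_const qfB qf_scalar => H.
apply: affine_le; apply: H.
by rewrite -mulmxA mulmxBr mulmx1 mulmxBl -(mulmxA v P) PW (mulmxA v) vW.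
Qed.

Let h := rdiag (fun i => Num.sqrt (a i - lmin)).
Let g (i : 'I_p) := (hev (h *m (X *m Y^t* *m (Y *m X^t*)) *m h))`_i.

Lemma lmin_le_invariant : (forall i j : 'I_p, (i <= j)%N -> a j <= a i) ->
  forall i, lmin <= a i.
Proof.
move=> adec i; have <- : (hev (rdiag a))`_i = a i by exact: hev_rdiag.
apply: hev_ge_const; first exact: adj_rdiag.
move=> v; have -> : qf (rdiag a) v = qf A (v *m X).
  by rewrite qf_mul XA -mulmxA XX mulmx1.
rewrite -(qf1_unitary v XX); apply: qf_ge_lmin.
by rewrite -!mulmxA [X *m _]mulmxA XW.
Qed.

(** Put [G = h *m X *m Y^t*]. By [qf_ge_invariant] the form of the compression to [Y], shifted by
    [lmin], dominates that of [G^t* *m G], whose positive eigenvalues are those of [G *m G^t*],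
    hence of [g]. Mapping eigenvectors of [G *m G^t*] by [G] gives a test space for [hev_ge]. *)
Lemma ritz_value_ge (i : 'I_p) : (forall i j : 'I_p, (i <= j)%N -> a j <= a i) ->
  g i + lmin <= (hev (Y *m A *m Y^t*))`_i.
Proof.
move=> adec; have a0 := lmin_le_invariant adec.
have NN : (Y *m A *m Y^t*)^t* = Y *m A *m Y^t* by exact: hermitian_congr.
have iq : (i < q)%N := leq_trans (ltn_ord i) pq.
have YW' y : y *m Y *m W^t* *m W = y *m Y by rewrite -!mulmxA [Y *m _]mulmxA YW.
(* For [g i <= 0] the bound by [lmin] suffices; otherwise positivity makes the test map
   injective. *)
have [g0|g_gt0] := leP (g i) 0.
  apply: le_trans (_ : lmin <= _); first by rewrite gerDr.
  apply: (hev_ge_const (Ordinal iq)); first exact: NN.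
  by move=> y; rewrite -qf_mul -(qf1_unitary y YY); exact: qf_ge_lmin.
have hh : h^t* = h by exact: adj_rdiag.
have [G Gadj GG] : exists2 G : 'M[C]_(p, q), G^t* = Y *m X^t* *m h &
    G *m G^t* = h *m (X *m Y^t* *m (Y *m X^t*)) *m h.
  have Gadj : (h *m (X *m Y^t*))^t* = Y *m X^t* *m h by rewrite !adjM trmxCK hh.
  by exists (h *m (X *m Y^t*)); rewrite // Gadj !mulmxA.
have GGh : (G *m G^t*)^t* = G *m G^t* by rewrite adjM trmxCK.
have [S SS GGE] := hev_spectral GGh.
set l := (fun j : 'I_p => _) in GGE.
have gl (j : 'I_p) : l j = g j by rewrite /l GG.
have SGG : S *m (G *m G^t*) = rdiag l *m S.
  by rewrite {1}GGE !mulmxA SS mul1mx.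
pose Q := pid_mx i.+1 : 'M[C]_(i.+1, p).
(* On the leading eigenvectors, [G] multiplies the squared lengths of coordinates by [l], and a
   further application of [G^t*] by [l] again, so the Rayleigh quotient is at least [g i]. *)
have F1 u : qf 1%:M (u *m (Q *m S *m G)) = qf (rdiag l) (u *m Q).
  rewrite !mulmxA qf_mul mulmx1 qf_mul SGG.
  by rewrite -mulmxA SS mulmx1.
have F2 u : qf 1%:M (u *m (Q *m S *m G) *m G^t*) = qf (rdiag (fun j => l j * l j)) (u *m Q).
  rewrite -!mulmxA SGG !mulmxA (qf1_unitary _ SS) qf_mul mulmx1 adj_rdiag.
  by rewrite rdiagM.
apply: (@hev_ge _ _ _ _ (Q *m S *m G)) iq; first exact: NN.
  move=> u u0; rewrite F1; apply: lt_le_trans (_ : g i * qf 1%:M u <= _).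
    by rewrite mulr_gt0 ?qf1_gt0.
  rewrite -(qf1_pid u (ltn_ord i)) -qf_scalar -rdiag_const; apply: qf_pid_le.
  by move=> j ji; rewrite gl; apply: hev_dec.
move=> u; set y := u *m _; rewrite -qf_mul.
have := qf_ge_invariant (YW' _ y); rewrite (qf1_unitary y YY).
apply: le_trans; rewrite mulrDl addrC lerD2l.
have -> : qf (rdiag (fun j => a j - lmin)) (y *m Y *m X^t*) = qf 1%:M (y *m G^t*).
  rewrite Gadj !mulmxA [RHS]qf_mul mulmx1 hh rdiagM; congr (qf _ _).
  by apply: eq_rdiag => j; rewrite -expr2 sqr_sqrtr ?subr_ge0.
rewrite F1 F2 -qf_scale; apply: qf_pid_le => j ji.
have gij : g i <= l j by rewrite gl; apply: hev_dec.
by rewrite ler_wpM2r // (le_trans _ gij) // ltW.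
Qed.

End Comparison.

(** * Ritz value bounds for arbitrary orthonormal bases *)

Section Ritz.
Local Open Scope sesquilinear_scope.
Local Open Scope complex_scope.
Variables (R : realType) (n m p q : nat).
Local Notation C := R[i].
Variables (A : 'M[C]_n) (X : 'M[C]_(p, n)) (Y : 'M[C]_(q, n)) (W : 'M[C]_(m, n)).
Hypothesis AA : A^t* = A.
Hypotheses (XX : X *m X^t* = 1%:M) (YY : Y *m Y^t* = 1%:M) (WW : W *m W^t* = 1%:M).
Hypotheses (XW : X *m W^t* *m W = X) (YW : Y *m W^t* *m W = Y).
Hypothesis pq : (p <= q)%N.
Hypothesis XA : X *m A = X *m A *m X^t* *m X.
Let lmin := last 0 (hev (W *m A *m W^t*)).
Let a (i : 'I_p) := (hev (X *m A *m X^t*))`_i - lmin.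
Let b (i : 'I_p) := (hev (Y *m A *m Y^t*))`_i - lmin.
Let K := X *m Y^t* *m (Y *m X^t*).
Let c (i : 'I_p) := (hev K)`_(rev_ord i).

(** The form of [K] at [v] is the squared length of the projection of [v *m X] to the rows of [Y];
    the complementary projection has nonnegative squared length too. *)
Lemma contraction_product v : 0 <= qf K v /\ qf K v <= qf 1%:M v.
Proof.
have -> : qf K v = qf 1%:M (v *m X *m Y^t*).
  by rewrite !qf_mul trmxCK /K !mulmxA mulmx1.
split; first exact: qf1_ge0.
set w := v *m X; rewrite -(qf1_unitary v XX) -/w.
move: w => w; pose P := 1%:M - Y^t* *m Y.
have PP : P *m 1%:M *m P^t* = 1%:M - Y^t* *m Y.
  rewrite mulmx1 adjB trmx1 map_mx1 adjM trmxCK mulmxBr mulmx1 mulmxBl mul1mx.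
  by rewrite -[Y^t* *m Y *m _]mulmxA [Y *m (_ *m _)]mulmxA YY mul1mx subrr subr0.
have := qf1_ge0 (w *m P); rewrite qf_mul PP qfB subr_ge0.
by rewrite [qf _ (w *m Y^t*)]qf_mul mulmx1 trmxCK.
Qed.

(** Rotating the basis [X] by [U] makes it consist of eigenvectors of [A]. This changes [K] only by
    a unitary similarity, so [c] is unaffected, and the bounds for [g] pass to the larger [b]. *)
Lemma ritz_bounds :
  [/\ forall i, 0 <= a i, forall i, 0 <= c i <= 1,
      forall i j : 'I_p, (i <= j)%N -> c i <= c j,
      forall J : {set 'I_p}, (0 < #|J|)%N ->
        \sum_(i in J) (a i - b i) <= \sum_(i < p | (i < #|J|)%N) a i * (1 - c i) &
      (forall i, 0 < a i) -> (forall i, 0 < c i) -> (forall i, 0 < b i) /\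
      forall J : {set 'I_p}, (0 < #|J|)%N ->
        \sum_(i in J) ln (a i / b i) <= \sum_(i < p | (i < #|J|)%N) ln (c i)^-1].
Proof.
have Mh : (X *m A *m X^t*)^t* = X *m A *m X^t* by exact: hermitian_congr.
have Kh : K^t* = K by rewrite !adjM !trmxCK.
have [U UU ME] := hev_spectral Mh.
set l := (fun i : 'I_p => _) in ME.
have ldec (i j : 'I_p) : (i <= j)%N -> l j <= l i by move=> ij; exact: hev_dec.
have al i : a i = l i - lmin by [].
clearbody l.
pose X' := U *m X.
have XX' : X' *m X'^t* = 1%:M by rewrite adjM mulmxA -[_ *m _ *m X^t*]mulmxA XX mulmx1.
have XW' : X' *m W^t* *m W = X' by rewrite -!mulmxA [X *m _]mulmxA XW.
have XA' : X' *m A = rdiag l *m X'.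
  by rewrite -mulmxA XA ME !mulmxA UU mul1mx.
pose K' := X' *m Y^t* *m (Y *m X'^t*).
have K'E : K' = U *m K *m U^t* by rewrite /K' adjM !mulmxA.
have K'h : K'^t* = K' by rewrite K'E hermitian_congr.
have hevK : hev K' = hev K.
  apply: hev_char_poly; rewrite K'E; apply: char_poly_similar => //.
  exact: mulmx1C.
have K'0 v : 0 <= qf K' v.
  by rewrite K'E -qf_mul; case: (contraction_product (v *m U)).
have K'1 v : qf K' v <= qf 1%:M v.
  by rewrite K'E -qf_mul -(qf1_unitary v UU); case: (contraction_product (v *m U)).
have adec (i j : 'I_p) : (i <= j)%N -> a j <= a i.
  by move=> ij; rewrite !al lerD2r ldec.
have a0 i : 0 <= a i.
  by rewrite al subr_ge0; apply: (lmin_le_invariant AA XX' WW XW' XA').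
have cE i : c i = (hev K')`_(rev_ord i) by rewrite hevK.
pose h := rdiag (fun i => Num.sqrt (a i)).
pose g (i : 'I_p) := (hev (h *m K' *m h))`_i.
have hE : (fun i => Num.sqrt (a i)) =1 (fun i => Num.sqrt (l i - lmin)).
  by move=> i; rewrite al.
have gb i : g i <= b i.
  have := ritz_value_ge AA XX' YY WW XW' YW pq XA' i ldec.
  by rewrite -lerBrDr -(eq_rdiag hE).
split.
- exact: a0.
- by move=> i; rewrite cE (hev_rev_ge0 K'h K'0) (hev_rev_le1 K'h K'1).
- by move=> i j; rewrite !cE; exact: hev_rev_inc.
- move=> J J0; apply: le_trans (_ : \sum_(i in J) (a i - g i) <= _).
    by apply: ler_sum => i _; rewrite lerD2l lerN2.
  apply: le_trans (sum_gap_le adec a0 K'h K'0 K'1 J0) _.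
  by apply: ler_sum => i _; rewrite -cE.
- move=> a_gt0 c_gt0.
  have c_gt0' (i : 'I_p) : 0 < (hev K')`_(rev_ord i) by rewrite -cE.
  have g_gt0' i : 0 < g i by apply: (hev_weighted_gt0 adec a0 K'h K'0 a_gt0 c_gt0').
  have b_gt0 i : 0 < b i by exact: lt_le_trans (g_gt0' i) (gb i).
  split=> // J J0; apply: le_trans (_ : \sum_(i in J) ln (a i / g i) <= _).
    apply: ler_sum => i _; rewrite ler_ln ?posrE ?divr_gt0 //.
    by rewrite ler_pM2l // lef_pV2 ?posrE.
  apply: le_trans (sum_ln_ratio_le adec a0 K'h K'0 J0 a_gt0 c_gt0') _.
  by apply: ler_sum => i _; rewrite -cE.
Qed.

(** Cauchy interlacing; together with [contiguous_largest] it gives the nonnegativity of the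
    gaps. *)
Lemma ritz_value_le (i : 'I_p) :
  (hev (Y *m A *m Y^t*))`_i <= (hev A)`_i.
Proof.
apply: (@hev_le_isometry _ _ _ _ _ Y) => //; first exact: hermitian_congr.
- by move=> v; rewrite qf_mul.
- exact: leq_trans (ltn_ord i) pq.
Qed.

End Ritz.

(** * Independence of the characteristic polynomial from the basis *)

Section ChangeOfBasis.
Variables (K : fieldType) (V : vectType K).

Lemma coord_basis_change n m (b : n.-tuple V) (e : m.-tuple V) (v : V) (j : 'I_n) :
  basis_of fullv e -> coord b j v = \sum_i coord e i v * coord b j e`_i.
Proof.
move=> eb; rewrite {1}(coord_basis eb (memvf v)) linear_sum.
by apply: eq_bigr => i _; rewrite linearZ.
Qed.

(** Needed since [eigvals] is computed in [vbasis], whereas the argument takes place in orthonormal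
    bases. The two lengths are kept distinct, being equal only through a proof. *)
Lemma char_poly_basis (f : 'End(V)) n m (b : n.-tuple V) (e : m.-tuple V) :
  basis_of fullv b -> basis_of fullv e ->
  char_poly (\matrix_(i < n, j < n) coord b j (f b`_i)) =
  char_poly (\matrix_(i < m, j < m) coord e j (f e`_i)).
Proof.
move=> bb eb.
pose P := \matrix_(i < n, j < m) coord e j b`_i.
pose Q := \matrix_(i < m, j < n) coord b j e`_i.
have PQ : P *m Q = 1%:M.
  apply/matrixP => i j; rewrite !mxE -(coord_free _ _ (basis_free bb)).
  by rewrite (coord_basis_change _ _ _ eb); apply: eq_bigr => l _; rewrite !mxE.
have QP : Q *m P = 1%:M.
  apply/matrixP => i j; rewrite !mxE -(coord_free _ _ (basis_free eb)).
  by rewrite (coord_basis_change _ _ _ bb); apply: eq_bigr => l _; rewrite !mxE.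
rewrite -[RHS](char_poly_similar _ PQ QP); congr char_poly.
apply/matrixP => i j; rewrite !mxE (coord_basis_change _ _ _ eb).
apply: eq_bigr => l _; rewrite !mxE; congr (_ * _).
rewrite {1}(coord_basis eb (memvf b`_i)) !linear_sum.
by apply: eq_bigr => r _; rewrite !linearZ /= !mxE.
Qed.

End ChangeOfBasis.

(** * From real or complex inner product spaces to complex matrices *)

Section Bridge.
Local Open Scope sesquilinear_scope.
Local Open Scope complex_scope.
Variables (R : realType) (k : scalar_kind).
Local Notation K := (scalar_field R k).
Local Notation phi := (scalar_to_complex R k).
Local Notation conj := (scalar_conj R k).

Lemma scalar_to_complex_conj (x : K) : phi (conj x) = Num.conj (phi x).
Proof. by rewrite /scalar_to_complex /scalar_conj; destruct k => //; exact/esym/conjc_real. Qed.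

(** For [x] the squared length of a vector, [a] scales it to unit length; real and complex scalars
    need different square roots. *)
Lemma exists_normalizer (x : K) : 0 < x -> exists a : K, a * conj a * x = 1.
Proof.
rewrite /scalar_conj; destruct k => /= x0.
  exists (Num.sqrt x)^-1; rewrite -expr2 exprVn sqr_sqrtr ?ltW //.
  by rewrite mulVf ?gt_eqF.
exists (sqrtC x)^-1; rewrite -normCK normfV exprVn.
by rewrite ger0_norm ?sqrtC_ge0 ?ltW // sqrtCK mulVf ?gt_eqF.
Qed.

Lemma eigvals_basis (V : vectType K) (f : 'End(V)) d (e : d.-tuple V) :
  basis_of fullv e ->
  eigvals f = hev (\matrix_(i < d, j < d) phi (coord e j (f e`_i))).
Proof.
move=> eb; rewrite hev.unlock /eigvals.
have -> : \matrix_(i < d, j < d) phi (coord e j (f e`_i)) =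
  map_mx phi (\matrix_(i < d, j < d) coord e j (f e`_i)).
  by apply/matrixP => i j; rewrite !mxE.
rewrite -map_char_poly -(char_poly_basis f (vbasisP fullv) eb).
have -> : passmx.mxof (vbasis {:V}) (vbasis {:V}) f =
   \matrix_(i, j) coord (vbasis {:V}) j (f (vbasis {:V})`_i).
  by apply/matrixP => i j; rewrite !mxE /= passmx.vecof_delta.
by [].
Qed.

Variables (H : vectType K) (dotp : {dot H for conj}).
Implicit Types (Z : {vspace H}) (u v : H).

Lemma dotpC u v : dotp u v = conj (dotp v u).
Proof. by rewrite (hermC dotp) expr0 mul1r. Qed.

Lemma dotp_suml n (a : 'I_n -> K) (e : 'I_n -> H) v :
  dotp (\sum_i a i *: e i) v = \sum_i a i * dotp (e i) v.
Proof. by rewrite linear_sumlz; apply: eq_bigr => i _; rewrite linearZl_LR. Qed.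

Lemma dotp_gt0 u : u != 0 -> 0 < dotp u u.
Proof. exact: neq0_dnorm_gt0. Qed.

Definition onb Z d (e : d.-tuple H) :=
  basis_of Z e /\ forall i j : 'I_d, dotp e`_i e`_j = (i == j)%:R.

Lemma orthonormal_free d (e : d.-tuple H) :
  (forall i j : 'I_d, dotp e`_i e`_j = (i == j)%:R) -> free e.
Proof.
move=> on; apply/freeP => a a0 j.
have : dotp (\sum_(i < d) a i *: e`_i) e`_j = 0 by rewrite a0 linear0l.
rewrite dotp_suml (bigD1 j) //= on eqxx mulr1 big1 ?addr0 // => i ij.
by rewrite on (negbTE ij) mulr0.
Qed.

(** Gram-Schmidt by induction on the dimension: a vector of [Z] is normalized to [u], and the part
    of [Z] orthogonal to [u] has dimension one less. *)
Lemma exists_onb Z : exists e : (\dim Z).-tuple H, onb Z e.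
Proof.
move: {2}(\dim Z) (erefl (\dim Z)) => d; rewrite /onb.
suff : \dim Z = d -> exists e : d.-tuple H, basis_of Z e /\
    forall i j : 'I_d, dotp e`_i e`_j = (i == j)%:R by move=> E dZ; subst d; exact: E.
elim: d Z => [|d IH] Z dZ.
  exists [tuple]; split; last by case.
  by move/eqP: dZ; rewrite dimv_eq0 => /eqP ->; exact: nil_basis.
have Z0 : vpick Z != 0 by rewrite vpick0 -dimv_eq0 dZ.
have [a aE] := exists_normalizer (dotp_gt0 Z0).
pose u := a *: vpick Z.
have uu : dotp u u = 1 by rewrite linearZl_LR linearZr_LR /= mulrA.
have uZ : u \in Z by rewrite memvZ // memv_pick.
have uN : u \notin orthov dotp Z.
  apply/mem_orthovPn; exists u => //.
  by apply: (_ : dotp u u != 0); rewrite uu oner_eq0.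
have /esym := eq_dim_orthov1 uN; rewrite dZ /= => /IH[e [eb eo]].
have eP (i : 'I_d) : dotp e`_i u = 0.
  have: e`_i \in (Z :&: orthov dotp <[u]>)%VS.
    by apply: (basis_mem eb); rewrite mem_nth // size_tuple.
  by rewrite memv_cap => /andP[_ /mem_orthovP]; apply; exact: memv_line.
have on (i j : 'I_d.+1) : dotp [tuple of u :: e]`_i [tuple of u :: e]`_j = (i == j)%:R.
  case: (unliftP ord0 i) => [i'|] ->; case: (unliftP ord0 j) => [j'|] ->.
  - by rewrite (inj_eq lift_inj) /= eo.
  - by rewrite /= eP.
  - by rewrite /= dotpC eP rmorph0.
  - by rewrite /= uu.
exists [tuple of u :: e]; split => //.
rewrite basisEfree orthonormal_free //= dZ size_tuple leqnn andbT.
apply/span_subvP => v; rewrite inE => /orP[/eqP -> //|/(basis_mem eb)].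
by rewrite memv_cap => /andP[].
Qed.

Lemma onb_mem Z d (e : d.-tuple H) (i : 'I_d) : onb Z e -> e`_i \in Z.
Proof. by case=> eb _; apply: (basis_mem eb); rewrite mem_nth // size_tuple. Qed.

Lemma onb_expand Z d (e : d.-tuple H) u : onb Z e -> u \in Z ->
  u = \sum_(i < d) dotp u e`_i *: e`_i.
Proof.
case=> eb eo uZ; rewrite {1}(coord_basis eb uZ); apply: eq_bigr => j _.
congr (_ *: _); rewrite [in RHS](coord_basis eb uZ) dotp_suml.
rewrite (bigD1 j) //= eo eqxx mulr1 big1 ?addr0 // => i ij.
by rewrite eo (negbTE ij) mulr0.
Qed.

Lemma onb_dotp Z d (e : d.-tuple H) u v : onb Z e -> u \in Z ->
  dotp u v = \sum_(i < d) dotp u e`_i * dotp e`_i v.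
Proof. by move=> eb uZ; rewrite {1}(onb_expand eb uZ) dotp_suml. Qed.

Lemma orth_proj_mem Z u : orth_proj dotp Z u \in Z.
Proof. exact: memv_pi. Qed.

(** The projector along a direct sum behaves as intended because [Z] meets its orthogonal space
    trivially, the form being definite, and an orthonormal expansion shows that the two span
    everything. *)
Lemma dotp_orth_proj Z u v : v \in Z -> dotp (orth_proj dotp Z u) v = dotp u v.
Proof.
move=> vZ; have [e eb] := exists_onb Z.
have dis : (Z :&: orthov dotp Z)%VS = 0%VS.
  apply/eqP; rewrite -subv0; apply/subvP => w; rewrite memv_cap => /andP[wZ /mem_orthovP wO].
  by rewrite memv0; apply: contraT => /dotp_gt0; rewrite wO // ltxx.
have full : u \in (Z + orthov dotp Z)%VS.
  pose w := \sum_(i < \dim Z) dotp u e`_i *: e`_i.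
  have wZ : w \in Z by apply: memv_suml => i _; rewrite memvZ // (onb_mem _ eb).
  rewrite -[u](subrK w) addrC memv_add //; apply/mem_orthovP => z zZ.
  rewrite linearBl /= dotp_suml [dotp u z]dotpC (onb_dotp u eb zZ) rmorph_sum -sumrB.
  apply: big1 => i _; rewrite rmorphM /= -!dotpC mulrC subrr //.
rewrite -[in RHS](daddv_pi_add dis full) linearDl /=.
have /mem_orthovP-> // := memv_pi (orthov dotp Z) Z u.
by rewrite addr0.
Qed.

(** When [y] is an orthonormal basis, row [i] holds the coordinates of [x i]. The entries are
    complex for both kinds of scalars, so one matrix theory serves both. *)
Definition gram d d' (x : 'I_d -> H) (y : 'I_d' -> H) : 'M[R[i]]_(d, d') :=
  \matrix_(i, j) phi (dotp (x i) (y j)).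

Lemma adj_gram d d' (x : 'I_d -> H) (y : 'I_d' -> H) : (gram x y)^t* = gram y x.
Proof.
by apply/matrixP => i j; rewrite !mxE [in RHS]dotpC scalar_to_complex_conj.
Qed.

(** Parseval's identity in matrix form. *)
Lemma gram_mul Z n (e : n.-tuple H) d d' (x : 'I_d -> H) (y : 'I_d' -> H) :
  onb Z e -> (forall i, x i \in Z) ->
  gram x (fun i : 'I_n => e`_i) *m gram (fun i : 'I_n => e`_i) y = gram x y.
Proof.
move=> eb xZ; apply/matrixP => i j; rewrite !mxE (onb_dotp _ eb (xZ i)) rmorph_sum.
by apply: eq_bigr => l _; rewrite !mxE rmorphM.
Qed.

Lemma gram_onb Z n (e : n.-tuple H) : onb Z e ->
  gram (fun i : 'I_n => e`_i) (fun i : 'I_n => e`_i) = 1%:M.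
Proof.
by case=> _ eo; apply/matrixP => i j; rewrite !mxE eo rmorph_nat.
Qed.

Lemma eigvals_End n (e : n.-tuple H) (f : 'End(H)) : onb fullv e ->
  eigvals f = hev (gram (fun i : 'I_n => f e`_i) (fun i : 'I__ => e`_i)).
Proof.
case=> eb eo; rewrite (eigvals_basis f eb); congr hev.
apply/matrixP => i j; rewrite !mxE; congr (phi _).
rewrite [in RHS](coord_basis eb (memvf (f e`_i))) dotp_suml (bigD1 j) //=.
rewrite eo eqxx mulr1 big1 ?addr0 // => l lj.
by rewrite eo (negbTE lj) mulr0.
Qed.

Lemma eigvals_restrict Z d (e : d.-tuple H) (f : 'End(H)) : onb Z e ->
  (forall u, u \in Z -> f u \in Z) ->
  eigvals (restrict_op f Z) = hev (gram (fun i : 'I_d => f e`_i) (fun i : 'I__ => e`_i)).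
Proof.
move=> eb fZ; pose s := [tuple of map (vsproj Z) e].
have sE (i : 'I_d) : vsval s`_i = e`_i.
  by rewrite (nth_map 0) ?size_tuple // vsprojK // (onb_mem _ eb).
have eo := eb.2; have ef := basis_free eb.1.
have sumE (a : 'I_d -> K) : vsval (\sum_i a i *: s`_i) = \sum_i a i *: e`_i.
  by rewrite linear_sum; apply: eq_bigr => i _; rewrite linearZ /= sE.
have sf : free s.
  apply/freeP => a a0; move/freeP: ef; apply.
  by rewrite -sumE a0 linear0.
have sb : basis_of fullv s.
  rewrite basisEfree sf subvf size_tuple /= -(size_basis eb.1).
  by rewrite dimvf; exact: leqnn.
rewrite (eigvals_basis _ sb); congr hev.
apply/matrixP => i j; rewrite !mxE; congr (phi _).
set w := restrict_op _ _ _.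
have wE : vsval w = f e`_i.
  by rewrite /w /restrict_op lfunE /= sE vsprojK // fZ // (onb_mem _ eb).
rewrite -wE [in RHS](coord_basis sb (memvf w)) sumE dotp_suml (bigD1 j) //=.
rewrite eo eqxx mulr1 big1 ?addr0 // => l lj.
by rewrite eo (negbTE lj) mulr0.
Qed.

(** The projector disappears because the inner products are taken with vectors of [Z]. *)
Lemma eigvals_compression Z d (e : d.-tuple H) (f : 'End(H)) : onb Z e ->
  eigvals (compression dotp f Z) = hev (gram (fun i : 'I_d => f e`_i) (fun i : 'I__ => e`_i)).
Proof.
move=> eb; rewrite /compression (eigvals_restrict eb).
  congr hev; apply/matrixP => i j; rewrite !mxE lfunE /= dotp_orth_proj //.
  exact: onb_mem eb.
by move=> u _; rewrite lfunE /= orth_proj_mem.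
Qed.

End Bridge.

(** * Trigonometry of the principal angles *)

Section Angles.
Variable R : realType.
Implicit Types c : R.

Lemma cos2_acos_sqrt c : 0 <= c <= 1 -> cos (acos (Num.sqrt c)) ^+ 2 = c.
Proof.
move=> /andP[c0 c1]; rewrite acosK ?sqr_sqrtr // in_itv /=.
rewrite (le_trans _ (sqrtr_ge0 c)) ?oppr_le0 //=.
by rewrite -[leRHS]sqrtr1 ler_wsqrtr.
Qed.

Lemma sin2_acos_sqrt c : 0 <= c <= 1 -> sin (acos (Num.sqrt c)) ^+ 2 = 1 - c.
Proof. by move=> c01; rewrite sin2cos2 cos2_acos_sqrt. Qed.

Lemma tan2_acos_sqrt c : 0 < c <= 1 -> 1 + tan (acos (Num.sqrt c)) ^+ 2 = c^-1.
Proof.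
move=> /andP[c0 c1]; have cE : cos (acos (Num.sqrt c)) ^+ 2 = c.
  by rewrite cos2_acos_sqrt // ltW.
rewrite -cos2_tan2 ?cE //; apply: contraTneq c0 => cos0.
by rewrite -cE cos0 expr0n /= ltxx.
Qed.

(** A zero squared cosine would give the excluded angle [pi / 2]. *)
Lemma acos_sqrt_lt_pi2 c : 0 <= c -> acos (Num.sqrt c) < pi / 2 -> 0 < c.
Proof.
rewrite le_eqVlt => /predU1P[<-|//].
by rewrite sqrtr0 acos0 ltxx.
Qed.

End Angles.

Lemma eq_weak_major (R : realType) n (x x' y y' : 'I_n -> R) :
  x =1 x' -> y =1 y' -> weak_major x y -> weak_major x' y'.
Proof.
move=> xx yy; rewrite /weak_major /decreasing_rearr.
by rewrite (eq_codom xx) (eq_codom yy).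
Qed.

(** * The matrix bounds transported to subspaces and operators *)

Section Spectra.
Variables (R : realType) (k : scalar_kind) (H : vectType (scalar_field R k)).
Variables (dotp : {dot H for scalar_conj R k}) (X Y : {vspace H}) (A : 'End(H)).
Hypotheses (XY : (\dim X <= \dim Y)%N) (Ah : hermitian_operator dotp A).
Hypotheses (AX : (A @: X <= X)%VS) (AL : contiguous_largest A X).

Let p := \dim X.
Let a (i : 'I_p) := (eigvals (compression dotp A X))`_i - min_eigval dotp A (X + Y).
Let b (i : 'I_p) := (eigvals (compression dotp A Y))`_i - min_eigval dotp A (X + Y).
Let c (i : 'I_p) :=
  (eigvals (restrict_op (orth_proj dotp X \o orth_proj dotp Y)%VF X))`_(rev_ord i).

Lemma principal_anglesE (i : 'I_p) :
  (principal_angles dotp X Y)`_i = acos (Num.sqrt (c i)).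
Proof.
rewrite /principal_angles; set s := eigvals _.
have ss : size s = p.
  have [x xb] := exists_onb dotp X.
  rewrite /s (eigvals_restrict xb) ?size_hev // => u _.
  by rewrite lfunE /= orth_proj_mem.
by rewrite (nth_map 0) ?size_rev ?ss // nth_rev ?ss.
Qed.

Lemma rayleigh_ritz_bounds :
  [/\ forall i, 0 <= a i /\ b i <= a i, forall i, 0 <= c i <= 1,
      (forall i j : 'I_p, (i <= j)%N -> a j <= a i) /\
      (forall i j : 'I_p, (i <= j)%N -> c i <= c j),
      forall J : {set 'I_p}, (0 < #|J|)%N ->
        \sum_(i in J) (a i - b i) <= \sum_(i < p | (i < #|J|)%N) a i * (1 - c i) &
      (forall i, 0 < a i) -> (forall i, 0 < c i) -> (forall i, 0 < b i) /\
      forall J : {set 'I_p}, (0 < #|J|)%N ->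
        \sum_(i in J) ln (a i / b i) <= \sum_(i < p | (i < #|J|)%N) ln (c i)^-1].
Proof.
have [x xb] := exists_onb dotp X; have [y yb] := exists_onb dotp Y.
have [w wb] := exists_onb dotp (X + Y)%VS; have [h hb] := exists_onb dotp fullv.
pose fx (i : 'I_p) := x`_i; pose fy (i : 'I_(\dim Y)) := y`_i.
pose fw (i : 'I_(\dim (X + Y)%VS)) := w`_i; pose fh (i : 'I_(\dim {:H})) := h`_i.
have fxX i : fx i \in X by exact: onb_mem xb.
have fyY i : fy i \in Y by exact: onb_mem yb.
have fxW i : fx i \in (X + Y)%VS by apply: subvP (addvSl X Y) _ (fxX i).
have fyW i : fy i \in (X + Y)%VS by apply: subvP (addvSr X Y) _ (fyY i).
have AfxX i : A (fx i) \in X by apply: (subvP AX); rewrite memv_img.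
(* [A'] is the matrix of [A] in the orthonormal basis [h] of the whole space; subspaces become the
   coordinate matrices of their orthonormal bases. *)
pose A' := gram dotp (A \o fh) fh.
have A'E : A' = gram dotp fh (A \o fh).
  by apply/matrixP => i j; rewrite !mxE /= Ah.
have A'A' : (A'^t*)%sesqui = A' by rewrite {1}A'E adj_gram.
have gramh d d' (s : 'I_d -> H) (t : 'I_d' -> H) :
    gram dotp s fh *m gram dotp fh t = gram dotp s t.
  by apply: (gram_mul _ hb) => i; rewrite memvf.
have gramA d (s : 'I_d -> H) : gram dotp s fh *m A' = gram dotp (A \o s) fh.
  by rewrite A'E gramh; apply/matrixP => i j; rewrite !mxE /= Ah.
have comp d (s : 'I_d -> H) :
    gram dotp s fh *m A' *m (gram dotp s fh)^t*%sesqui = gram dotp (A \o s) s.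
  by rewrite gramA adj_gram gramh.
have iso d Z (s : d.-tuple H) : onb dotp Z s ->
    gram dotp (fun i : 'I_d => s`_i) fh *m
      (gram dotp (fun i : 'I_d => s`_i) fh)^t*%sesqui = 1%:M.
  by move=> sb; rewrite adj_gram gramh (gram_onb sb).
have sub d (s : 'I_d -> H) : (forall i, s i \in (X + Y)%VS) ->
    gram dotp s fh *m (gram dotp fw fh)^t*%sesqui *m gram dotp fw fh = gram dotp s fh.
  by move=> sW; rewrite adj_gram gramh; apply: (gram_mul _ wb).
have lminE : min_eigval dotp A (X + Y) =
    last 0 (hev (gram dotp fw fh *m A' *m (gram dotp fw fh)^t*%sesqui)).
  by rewrite /min_eigval (eigvals_compression _ wb) comp.
have invX : gram dotp fx fh *m A' =
    gram dotp fx fh *m A' *m (gram dotp fx fh)^t*%sesqui *m gram dotp fx fh.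
  by rewrite comp gramA; apply/esym; apply: (gram_mul _ xb).
have evX : eigvals (compression dotp A X) =
    hev (gram dotp fx fh *m A' *m (gram dotp fx fh)^t*%sesqui).
  by rewrite comp (eigvals_compression _ xb).
have evY : eigvals (compression dotp A Y) =
    hev (gram dotp fy fh *m A' *m (gram dotp fy fh)^t*%sesqui).
  by rewrite comp (eigvals_compression _ yb).
have evXY : eigvals (restrict_op (orth_proj dotp X \o orth_proj dotp Y)%VF X) =
    hev (gram dotp fx fh *m (gram dotp fy fh)^t*%sesqui *m
         (gram dotp fy fh *m (gram dotp fx fh)^t*%sesqui)).
  rewrite !adj_gram !gramh (eigvals_restrict xb); last first.
    by move=> u _; rewrite lfunE /= orth_proj_mem.
  congr hev; apply/matrixP => i j; rewrite !mxE lfunE /= dotp_orth_proj ?(fxX j) //.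
  rewrite (onb_dotp _ yb (orth_proj_mem _ _ _)) rmorph_sum.
  by apply: eq_bigr => l _; rewrite !mxE rmorphM /= dotp_orth_proj ?(fyY l).
have evA : eigvals A = hev A' by rewrite (eigvals_End _ hb).
(* By interlacing, a Ritz value of [Y] is at most the corresponding eigenvalue of [A], which [AL]
   identifies as one of [A] on [X]. *)
have ba (i : 'I_p) : b i <= a i.
  rewrite /a /b lerD2r evY.
  apply: le_trans (ritz_value_le A'A' (iso _ _ _ yb) XY i) _.
  rewrite -evA -[leLHS](nth_take 0 (ltn_ord i)) -/p -AL (eigvals_compression _ xb).
  rewrite (eigvals_restrict xb) // => u uX.
  by apply: (subvP AX); rewrite memv_img.
have := ritz_bounds A'A' (iso _ _ _ xb) (iso _ _ _ yb) (iso _ _ _ wb)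
  (sub _ _ fxW) (sub _ _ fyW) XY invX.
rewrite -lminE -evX -evY -evXY => -[a0 c01 cinc HJ Hln].
split.
- by move=> i; split; [exact: a0 | exact: ba].
- exact: c01.
- split; last exact: cinc.
  by move=> i j ij; rewrite /a lerD2r evX hev_dec.
- exact: HJ.
- exact: Hln.
Qed.

End Spectra.

(** * From sums over index sets to the three majorizations *)

Theorem theorem2p4 (R : realType) (k : scalar_kind) (H : vectType (scalar_field R k))
    (dotp : {dot H for scalar_conj R k}) (X Y : {vspace H}) (A : 'End(H)) :
  (\dim X <= \dim Y)%N ->
  hermitian_operator dotp A ->
  (A @: X <= X)%VS ->
  contiguous_largest A X ->
  let LX (i : 'I_(\dim X)) := (eigvals (compression dotp A X))`_i in
  let LY (i : 'I_(\dim X)) := (eigvals (compression dotp A Y))`_i in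
  let Theta (i : 'I_(\dim X)) := (principal_angles dotp X Y)`_i in
  let lmin := min_eigval dotp A (X + Y)%VS in
  ((forall i, 0 <= LX i - LY i) /\
   weak_major (fun i => LX i - LY i)
              (fun i => (LX i - lmin) * sin (Theta i) ^+ 2)) /\
  ((forall i, Theta i < pi / 2) -> (forall i, lmin < LX i) ->
   [/\ forall i, lmin < LY i,
       (forall i, 0 <= ln ((LX i - lmin) / (LY i - lmin))) /\
       weak_major (fun i => ln ((LX i - lmin) / (LY i - lmin)))
                  (fun i => ln (1 + tan (Theta i) ^+ 2)) &
       (forall i, 0 <= (LX i - LY i) / (LY i - lmin)) /\
       weak_major (fun i => (LX i - LY i) / (LY i - lmin))
                  (fun i => tan (Theta i) ^+ 2)]).
Proof.
move=> XY Ah AX AL LX LY Theta lmin.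
pose a i := LX i - lmin; pose b i := LY i - lmin.
pose c (i : 'I_(\dim X)) := (eigvals
  (restrict_op (orth_proj dotp X \o orth_proj dotp Y)%VF X))`_(rev_ord i).
have ThetaE i : Theta i = acos (Num.sqrt (c i)) by exact: principal_anglesE.
have [] := rayleigh_ritz_bounds XY Ah AX AL.
move=> ab c01 [adec cinc] Hgap Hln.
have {c01} c01 i : 0 <= c i <= 1 by exact: c01.
have {cinc} cinc (i j : 'I_(\dim X)) : (i <= j)%N -> c i <= c j by exact: cinc.
have {adec} adec (i j : 'I_(\dim X)) : (i <= j)%N -> a j <= a i by exact: adec.
have a0 i : 0 <= a i by case: (ab i).
have ba i : b i <= a i by case: (ab i).
have LXY i : LX i - LY i = a i - b i by rewrite /a /b opprB addrA subrK.
have {}Hgap (J : {set 'I_(\dim X)}) : (0 < #|J|)%N ->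
  \sum_(i in J) (a i - b i) <= \sum_(i < \dim X | (i < #|J|)%N) a i * (1 - c i).
  exact: Hgap.
have {}Hln : (forall i, 0 < a i) -> (forall i, 0 < c i) -> (forall i, 0 < b i) /\
  forall J : {set 'I_(\dim X)}, (0 < #|J|)%N ->
    \sum_(i in J) ln (a i / b i) <= \sum_(i < \dim X | (i < #|J|)%N) ln (c i)^-1.
  exact: Hln.
clearbody c.
split.
  split=> [i|]; first by rewrite LXY subr_ge0.
  (* The right-hand vector is nonincreasing as a product of two nonnegative nonincreasing
     vectors. *)
  apply: weak_major_le_on_sets => [i j ij|J J0].
    rewrite !ThetaE !sin2_acos_sqrt // ler_pM ?a0 ?adec ?lerD2l ?lerN2 ?cinc //.
    by rewrite subr_ge0; case/andP: (c01 j).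
  under eq_bigr do rewrite LXY.
  under [leRHS]eq_bigr do rewrite ThetaE sin2_acos_sqrt //.
  exact: Hgap.
move=> Theta_lt lmin_lt.
have c0 i : 0 < c i.
  by apply: acos_sqrt_lt_pi2; [case/andP: (c01 i) | rewrite -ThetaE].
have c1 i : 0 < c i <= 1 by rewrite c0; case/andP: (c01 i).
have a_gt0 i : 0 < a i by rewrite subr_gt0.
have [b0 {}Hln] := Hln a_gt0 c0.
have tanE i : 1 + tan (Theta i) ^+ 2 = (c i)^-1 by rewrite ThetaE tan2_acos_sqrt.
have ab1 i : 1 <= a i / b i by rewrite ler_pdivlMr // mul1r.
have ln_major : weak_major (fun i => ln (a i / b i)) (fun i => ln (1 + tan (Theta i) ^+ 2)).
  apply: weak_major_le_on_sets => [i j ij|J J0].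
    by rewrite !tanE ler_ln ?posrE ?invr_gt0 // lef_pV2 ?posrE // cinc.
  under [leRHS]eq_bigr do rewrite tanE.
  exact: Hln.
(* The relative gap is the exponential of the logarithmic ratio minus 1, so [weak_major_expR]
   derives the tangent bound from [ln_major]. *)
have ratioE i : (LX i - LY i) / b i = a i / b i - 1.
  by rewrite LXY mulrBl divff // gt_eqF.
split.
- by move=> i; rewrite -subr_gt0; exact: b0.
- by split=> // i; exact: ln_ge0 (ab1 i).
- split=> [i|]; first by rewrite -/(b i) ratioE subr_ge0.
  apply: eq_weak_major (weak_major_expR ln_major) => i.
    by rewrite lnK ?posrE ?divr_gt0 // -ratioE.
  by rewrite lnK ?tanE ?posrE ?invr_gt0 // -tanE addrAC subrr add0r.
Qed.
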